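(* Let $A,E\in\mathbb{R}^{n\times m}$, $\widetilde A=A+E$, and $1\le r<\min\{n,m\}$. Let $A_r$ and $\widetilde A_r$ be the rank-$r$ thresholdings of $A$ and $\widetilde A$. Then \[\|A_r-\widetilde A_r\|\le 2\|E\|+2\sigma_{r+1}\min\Big\{\frac{2\|E\|}{\sigma_r-\sigma_{r+1}},1\Big\},\] \[\|A_r-\widetilde A_r\|_F\le\Big(2\|E_r\|_F^2+3\Big(\|E_r\|_F+\|(\Sigma_2)_r\|_F\min\Big\{\frac{2\|E\|}{\sigma_r-\sigma_{r+1}},1\Big\}\Big)^2\Big)^{1/2},\] where the minima are interpreted as $1$ when $\sigma_r=\sigma_{r+1}$.
   Context: $\sigma_1\ge\sigma_2\ge\dots$ are the singular values of $A$. For a matrix $M$, $M_r$ denotes its rank-$r$ hard thresholding: in an SVD of $M$, all but the first $r$ (largest) singular values are set to $0$. $\Sigma_2$ is the (rectangular) diagonal matrix with diagonal entries $\sigma_{r+1},\dots,\sigma_{\min\{n,m\}}$, so $\|(\Sigma_2)_r\|_F^2=\sum_{k=1}^{r}\sigma_{r+k}^2$ (with $\sigma_i=0$ for $i>\min\{n,m\}$). $\|\cdot\|$ is the spectral norm and $\|\cdot\|_F$ the Frobenius norm. *)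

(* Defs.v *)
From mathcomp Require Import all_boot all_order all_algebra.
From mathcomp Require Import classical_sets reals.
Set Implicit Arguments. Unset Strict Implicit. Unset Printing Implicit Defensive.
Import Order.TTheory GRing.Theory Num.Theory.
Local Open Scope ring_scope.
Local Open Scope classical_set_scope.

Section Defs.
Variable R : realType.

Definition vnorm (k : nat) (x : 'cV[R]_k) : R :=
  Num.sqrt (\sum_(i < k) x i 0 ^+ 2).

Definition specnorm (n m : nat) (M : 'M[R]_(n, m)) : R :=
  sup [set vnorm (M *m x) | x in [set x : 'cV[R]_m | vnorm x <= 1]].

Definition frobnorm (n m : nat) (M : 'M[R]_(n, m)) : R :=
  Num.sqrt (\sum_(i < n) \sum_(j < m) M i j ^+ 2).

(* Rectangular diagonal matrix with diagonal entries s 0, s 1, ...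
   (0-indexed: s k is the (k+1)-st singular value sigma_{k+1}). *)
Definition rdiag (n m : nat) (s : nat -> R) : 'M[R]_(n, m) :=
  \matrix_(i < n, j < m) (if (i : nat) == j then s i else 0).

Definition rdiag_r (n m : nat) (r : nat) (s : nat -> R) : 'M[R]_(n, m) :=
  \matrix_(i < n, j < m) (if ((i : nat) == j) && (i < r)%N then s i else 0).

Definition is_svd (n m : nat) (M : 'M[R]_(n, m))
    (U : 'M[R]_n) (s : nat -> R) (V : 'M[R]_m) : Prop :=
  [/\ U^T *m U = 1%:M /\ V^T *m V = 1%:M,
      (forall k, 0 <= s k), (forall k, s k.+1 <= s k),
      (forall k, (minn n m <= k)%N -> s k = 0)
    & M = U *m rdiag n m s *m V^T].

Definition hard_thr (n m : nat) (r : nat)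
    (U : 'M[R]_n) (s : nat -> R) (V : 'M[R]_m) : 'M[R]_(n, m) :=
  U *m rdiag_r n m r s *m V^T.

Definition min_ratio1 (a d : R) : R :=
  if d == 0 then 1 else Num.min (a / d) 1.

End Defs.

(* Main.v *)
Require Import Defs.
From mathcomp Require Import all_boot all_order all_algebra.
From mathcomp Require Import classical_sets reals topology normedtype derive realfun.
From mathcomp Require Import ring lra zify.
Import Order.TTheory GRing.Theory Num.Theory.
Import numFieldNormedType.Exports.
Local Open Scope ring_scope.

(** Write [P], [Q] (resp. [Pt], [Qt]) for the orthogonal projections onto the
    leading [r] left and right singular spaces of [A] (resp. [A + E]), and
    [D = A_r - At_r], where [A_r = A Q = P A] and [At_r = (A + E) Qt].  Then
    [D Qt = - (E + (A - A_r)) Qt] and [D (1 - Qt) = A_r (1 - Qt)].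

    If [2 ||E|| < sigma_r - sigma_{r+1}], Weyl's inequality and Wedin's argument
    bound [||Pt (1 - P)||] and [||(1 - Q) Qt||] by the ratio [mu], and moreover
    every principal angle between the two left singular spaces is below 45
    degrees, so [|P x|^2 <= 2 |Pt P x|^2].  Since
    [Pt A_r (1 - Qt) = - Pt (E + (1 - P) (A - A_r)) (1 - Qt)], both column parts
    of [D] are controlled and the sum of squares is at most [3 (...)^2].
    Otherwise [mu = 1], and the bounds follow from Weyl's inequality, in the
    Frobenius case from its version for the tail sums
    [sigma_{r+1}^2 + ... + sigma_{2r}^2]. *)

Section TruncatedSVD.
Set Implicit Arguments. Unset Strict Implicit. Unset Printing Implicit Defensive.
Variable R : realType.

(** * The Frobenius inner product and operator bounds *)

Implicit Types n m k : nat.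

Definition mxdot {n m} (M N : 'M[R]_(n, m)) : R := \tr (M^T *m N).

Lemma mxdotE n m (M N : 'M[R]_(n, m)) :
  mxdot M N = \sum_(i < n) \sum_(j < m) M i j * N i j.
Proof.
rewrite exchange_big; apply: eq_bigr => j _; rewrite mxE.
by apply: eq_bigr => i _; rewrite mxE.
Qed.

Lemma mxdotC n m (M N : 'M[R]_(n, m)) : mxdot M N = mxdot N M.
Proof. by rewrite !mxdotE; under eq_bigr do under eq_bigr do rewrite mulrC. Qed.

Lemma mxdotDr n m (M N K : 'M[R]_(n, m)) : mxdot M (N + K) = mxdot M N + mxdot M K.
Proof. by rewrite /mxdot mulmxDr mxtraceD. Qed.

Lemma mxdotDl n m (M N K : 'M[R]_(n, m)) : mxdot (N + K) M = mxdot N M + mxdot K M.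
Proof. by rewrite mxdotC mxdotDr !(mxdotC M). Qed.

Lemma mxdotZr n m a (M N : 'M[R]_(n, m)) : mxdot M (a *: N) = a * mxdot M N.
Proof. by rewrite /mxdot -scalemxAr mxtraceZ. Qed.

Lemma mxdotZl n m a (M N : 'M[R]_(n, m)) : mxdot (a *: N) M = a * mxdot N M.
Proof. by rewrite mxdotC mxdotZr mxdotC. Qed.

Lemma mxdotNr n m (M N : 'M[R]_(n, m)) : mxdot M (- N) = - mxdot M N.
Proof. by rewrite -scaleN1r mxdotZr mulN1r. Qed.

Lemma mxdotNl n m (M N : 'M[R]_(n, m)) : mxdot (- N) M = - mxdot N M.
Proof. by rewrite mxdotC mxdotNr mxdotC. Qed.

Lemma mxdot0r n m (M : 'M[R]_(n, m)) : mxdot M 0 = 0.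
Proof. by rewrite /mxdot mulmx0 mxtrace0. Qed.

Lemma mxdot_adj n m k (A : 'M[R]_(n, m)) (X : 'M_(m, k)) Y :
  mxdot (A *m X) Y = mxdot X (A^T *m Y).
Proof. by rewrite /mxdot trmx_mul mulmxA. Qed.

Lemma mxdot_ge0 n m (M : 'M[R]_(n, m)) : 0 <= mxdot M M.
Proof.
by rewrite mxdotE; apply: sumr_ge0 => i _; apply: sumr_ge0 => j _; rewrite -expr2 sqr_ge0.
Qed.

Lemma frobnormE n m (M : 'M[R]_(n, m)) : frobnorm M = Num.sqrt (mxdot M M).
Proof. by rewrite mxdotE. Qed.

Lemma frobnorm_ge0 n m (M : 'M[R]_(n, m)) : 0 <= frobnorm M.
Proof. exact: sqrtr_ge0. Qed.

Lemma frobnorm_sqr n m (M : 'M[R]_(n, m)) : frobnorm M ^+ 2 = mxdot M M.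
Proof. by rewrite frobnormE sqr_sqrtr ?mxdot_ge0. Qed.

Lemma frobnorm_eq0 n m (M : 'M[R]_(n, m)) : frobnorm M = 0 -> M = 0.
Proof.
move=> M0; have : mxdot M M = 0 by rewrite -frobnorm_sqr M0 expr0n.
rewrite mxdotE => /psumr_eq0P s0; apply/matrixP => i j; rewrite mxE.
have /psumr_eq0P : \sum_(j < m) M i j * M i j = 0.
  by apply: s0 => // i' _; apply: sumr_ge0 => j' _; rewrite -expr2 sqr_ge0.
move=> s1; apply/eqP; rewrite -[_ == 0](@sqrf_eq0 R) expr2; apply/eqP/s1 => // j' _.
by rewrite -expr2 sqr_ge0.
Qed.

(** Cauchy-Schwarz: for nonzero [N], expand the square of [|N|^2 M - <M, N> N] and cancel the factor
    [|N|^2]. *)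
Lemma mxdot_le n m (M N : 'M[R]_(n, m)) : mxdot M N <= frobnorm M * frobnorm N.
Proof.
have [/frobnorm_eq0 ->|N0] := eqVneq (frobnorm N) 0.
  by rewrite mxdot0r mulr_ge0 ?frobnorm_ge0.
have b0 : 0 < frobnorm N by rewrite lt_def N0 frobnorm_ge0.
have := mxdot_ge0 (frobnorm N ^+ 2 *: M - mxdot M N *: N).
rewrite mxdotDl !mxdotDr !mxdotNl !mxdotNr !mxdotZl !mxdotZr (mxdotC N M).
rewrite -!frobnorm_sqr; have := frobnorm_ge0 M.
move: (frobnorm M) (frobnorm N) (mxdot M N) b0 => a b d b0 a0 H.
have : 0 <= b ^+ 2 * ((a * b) ^+ 2 - d ^+ 2) by lra.
rewrite pmulr_rge0 ?exprn_gt0 // subr_ge0 => H'.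
apply: le_trans (ler_norm _) _; rewrite -(@ler_pXn2r _ 2) ?nnegrE ?normr_ge0 ?mulr_ge0 ?(ltW b0) //.
by rewrite real_normK ?num_real.
Qed.

Lemma frobnormD n m (M N : 'M[R]_(n, m)) : frobnorm (M + N) <= frobnorm M + frobnorm N.
Proof.
rewrite -(@ler_pXn2r _ 2) ?nnegrE ?addr_ge0 ?frobnorm_ge0 //.
rewrite frobnorm_sqr mxdotDl !mxdotDr (mxdotC N M) sqrrD !frobnorm_sqr.
have := mxdot_le M N; lra.
Qed.

Lemma frobnormN n m (M : 'M[R]_(n, m)) : frobnorm (- M) = frobnorm M.
Proof. by rewrite !frobnormE mxdotNl mxdotNr opprK. Qed.

Lemma frobnormB n m (M N : 'M[R]_(n, m)) : frobnorm (M - N) <= frobnorm M + frobnorm N.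
Proof. by rewrite -(frobnormN N) frobnormD. Qed.

Lemma frobnormZ n m a (M : 'M[R]_(n, m)) : frobnorm (a *: M) = `|a| * frobnorm M.
Proof.
by rewrite !frobnormE mxdotZl mxdotZr mulrA -expr2 sqrtrM ?sqr_ge0 // sqrtr_sqr.
Qed.

Lemma frobnorm0 n m : frobnorm (0 : 'M[R]_(n, m)) = 0.
Proof. by rewrite frobnormE mxdot0r sqrtr0. Qed.

Lemma frobnorm_tr n m (M : 'M[R]_(n, m)) : frobnorm M^T = frobnorm M.
Proof. by rewrite !frobnormE /mxdot trmxK mxtrace_mulC. Qed.

Lemma frobnorm_isom n m k (U : 'M[R]_(n, m)) (M : 'M_(m, k)) :
  U^T *m U = 1%:M -> frobnorm (U *m M) = frobnorm M.
Proof. by move=> UU; rewrite !frobnormE mxdot_adj mulmxA UU mul1mx. Qed.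

Lemma frobnorm_col n m (M : 'M[R]_(n, m)) :
  frobnorm M ^+ 2 = \sum_(j < m) frobnorm (col j M) ^+ 2.
Proof.
rewrite frobnorm_sqr mxdotE exchange_big; apply: eq_bigr => j _.
rewrite frobnorm_sqr mxdotE; apply: eq_bigr => i _.
by rewrite big_ord1 !mxE.
Qed.

Lemma vnormE k (x : 'cV[R]_k) : vnorm x = frobnorm x.
Proof.
by rewrite /vnorm /frobnorm; congr Num.sqrt; apply: eq_bigr => i _; rewrite big_ord1.
Qed.

(** An upper bound for the operator norm in pointwise form, which composes and transposes without
    any supremum; [specnorm_opbound] and [specnorm_le] translate from and to [specnorm]. *)
Definition opbound {n m} (M : 'M[R]_(n, m)) c :=
  forall x : 'cV_m, frobnorm (M *m x) <= c * frobnorm x.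

Lemma opbound_mx n m k (M : 'M[R]_(n, m)) c (X : 'M_(m, k)) :
  0 <= c -> opbound M c -> frobnorm (M *m X) <= c * frobnorm X.
Proof.
move=> c0 Mc; rewrite -(@ler_pXn2r _ 2) ?nnegrE ?mulr_ge0 ?frobnorm_ge0 //.
rewrite exprMn !frobnorm_col mulr_sumr; apply: ler_sum => j _.
rewrite -exprMn ler_pXn2r ?nnegrE ?mulr_ge0 ?frobnorm_ge0 //.
by rewrite colE -mulmxA -colE.
Qed.

(** [|M^T x|^2 = <x, M M^T x> <= |x| c |M^T x|], and one factor [|M^T x|] cancels. *)
Lemma opbound_tr n m (M : 'M[R]_(n, m)) c : 0 <= c -> opbound M c -> opbound M^T c.
Proof.
move=> c0 Mc x; have [->|N0] := eqVneq (frobnorm (M^T *m x)) 0.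
  by rewrite mulr_ge0 ?frobnorm_ge0.
have p0 : 0 < frobnorm (M^T *m x) by rewrite lt_def N0 frobnorm_ge0.
rewrite -(ler_pM2l p0) -expr2 frobnorm_sqr mxdot_adj trmxK.
apply: le_trans (mxdot_le _ _) _; rewrite mulrC.
rewrite mulrA (mulrC _ c); apply: ler_wpM2r (Mc _); exact: frobnorm_ge0.
Qed.

Lemma opboundM n m k (M : 'M[R]_(n, m)) (N : 'M_(m, k)) a b :
  0 <= a -> opbound M a -> opbound N b -> opbound (M *m N) (a * b).
Proof.
move=> a0 Ma Nb x; rewrite -mulmxA -mulrA.
by apply: le_trans (Ma _) _; rewrite ler_wpM2l.
Qed.

Lemma opbound_le n m (M : 'M[R]_(n, m)) a b : a <= b -> opbound M a -> opbound M b.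
Proof. by move=> ab Ma x; apply: le_trans (Ma x) _; rewrite ler_wpM2r ?frobnorm_ge0. Qed.

(** Cauchy-Schwarz on each row of [M]. The bound is crude, but it makes the supremum in [specnorm]
    finite. *)
Lemma opbound_frobnorm n m (M : 'M[R]_(n, m)) : opbound M (frobnorm M).
Proof.
move=> x; rewrite -(@ler_pXn2r _ 2) ?nnegrE ?mulr_ge0 ?frobnorm_ge0 //.
rewrite exprMn -(frobnorm_tr M) (frobnorm_col M^T) mulr_suml.
rewrite (frobnorm_sqr (M *m x)) mxdotE; apply: ler_sum => i _.
rewrite big_ord1 -expr2.
have -> : (M *m x) i 0 = mxdot (col i M^T) x.
  by rewrite mxdotE mxE; apply: eq_bigr => j _; rewrite big_ord1 !mxE.
rewrite -real_normK ?num_real // -exprMn ler_pXn2r ?nnegrE ?mulr_ge0 ?frobnorm_ge0 //.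
rewrite ler_norml mxdot_le lerNl -mxdotNl.
by rewrite (le_trans (mxdot_le _ _)) // frobnormN.
Qed.

Lemma specnorm_has_sup n m (M : 'M[R]_(n, m)) :
  has_sup [set vnorm (M *m x) | x in [set x : 'cV[R]_m | vnorm x <= 1]]%classic.
Proof.
split; first by exists (vnorm (M *m 0)), 0 => //=; rewrite vnormE frobnorm0.
exists (frobnorm M) => _ [x /= x1 <-]; rewrite vnormE in x1; rewrite vnormE.
apply: le_trans (opbound_frobnorm M x) _.
by rewrite -[leRHS]mulr1 ler_wpM2l ?frobnorm_ge0.
Qed.

Lemma specnorm_opbound n m (M : 'M[R]_(n, m)) : opbound M (specnorm M).
Proof.
move=> x; have [x0|N0] := eqVneq (frobnorm x) 0.
  by rewrite x0 (frobnorm_eq0 x0) mulmx0 frobnorm0 mulr0.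
have p0 : 0 < frobnorm x by rewrite lt_def N0 frobnorm_ge0.
rewrite -ler_pdivrMr // mulrC.
have -> : (frobnorm x)^-1 * frobnorm (M *m x) = vnorm (M *m ((frobnorm x)^-1 *: x)).
  by rewrite vnormE -scalemxAr frobnormZ ger0_norm ?invr_ge0 ?frobnorm_ge0.
have /sup_upper_bound := specnorm_has_sup M; apply.
exists ((frobnorm x)^-1 *: x) => //=.
by rewrite vnormE frobnormZ ger0_norm ?invr_ge0 ?frobnorm_ge0 // mulVf.
Qed.

Lemma specnorm_ge0 n m (M : 'M[R]_(n, m)) : 0 <= specnorm M.
Proof.
have /sup_upper_bound := specnorm_has_sup M; apply.
by exists 0; rewrite /= ?mulmx0 vnormE frobnorm0.
Qed.

Lemma specnorm_le n m (M : 'M[R]_(n, m)) c : 0 <= c -> opbound M c -> specnorm M <= c.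
Proof.
move=> c0 Mc; apply: ge_sup; first by have [] := specnorm_has_sup M.
move=> _ [x /= x1 <-]; rewrite vnormE in x1; rewrite vnormE.
by apply: le_trans (Mc x) _; rewrite -[leRHS]mulr1 ler_wpM2l.
Qed.

(** * Singular value decompositions *)

(** Supplies the test spaces of the Weyl inequalities by dimension counting. A unit vector killed by
    [G] and orthogonal to the columns found so far exists as long as [G] stacked on [W^T] has rank
    below [m]. *)
Lemma orthonormal_kernel a m b (G : 'M[R]_(a, m)) : (\rank G + b <= m)%N ->
  exists2 W : 'M[R]_(m, b), W^T *m W = 1%:M & G *m W = 0.
Proof.
elim: b => [|b IHb] rkG.
  by exists 0; [apply/matrixP => -[] | rewrite mulmx0].
have [W W1 GW] : exists2 W : 'M[R]_(m, b), W^T *m W = 1%:M & G *m W = 0.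
  by apply: IHb; apply: leq_trans rkG; rewrite leq_add2l.
pose H := col_mx G W^T.
have rkH : (\rank H^T < m)%N.
  apply: leq_trans rkG; rewrite addnS ltnS mxrank_tr -addsmxE.
  apply: leq_trans (mxrank_adds_leqif _ _) _.
  by rewrite leq_add2l rank_leq_row.
have : kermx H^T != 0 by rewrite -mxrank_eq0 mxrank_ker subn_eq0 -ltnNge.
move=> /rowV0Pn [v /sub_kermxP vH v0].
have Hv : H *m v^T = 0 by rewrite -[H]trmxK -trmx_mul vH trmx0.
have [Gv Wv] : G *m v^T = 0 /\ W^T *m v^T = 0.
  by move: Hv; rewrite mul_col_mx -col_mx0 => /eq_col_mx.
have nv0 : frobnorm v^T != 0.
  by apply: contraNneq v0 => /frobnorm_eq0 v0; rewrite -[v]trmxK v0 trmx0.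
pose x := (frobnorm v^T)^-1 *: v^T.
exists (row_mx x W : 'M_(m, 1 + b)); last first.
  apply: etrans (mul_mx_row G x W) _.
  by rewrite -scalemxAr Gv scaler0 GW row_mx0.
apply: etrans (_ : (row_mx x W)^T *m row_mx x W = 1%:M) _; last by [].
rewrite tr_row_mx mul_col_row scalar_mx_block W1.
have -> : W^T *m x = 0 by rewrite -scalemxAr Wv scaler0.
have -> : x^T *m W = 0 by rewrite -[W]trmxK -trmx_mul -scalemxAr Wv scaler0 trmx0.
suff -> : x^T *m x = 1%:M by [].
apply/matrixP => i j; rewrite !ord1 [RHS]mxE eqxx /=.
transitivity (mxdot x x); first by rewrite /mxdot /mxtrace big_ord1.
rewrite mxdotZl mxdotZr -frobnorm_sqr; field.
exact: nv0.
Qed.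

Lemma frobnorm_orthonormal m b (W : 'M[R]_(m, b)) :
  W^T *m W = 1%:M -> frobnorm W ^+ 2 = b%:R.
Proof. by move=> W1; rewrite frobnorm_sqr /mxdot W1 mxtrace1. Qed.

Lemma frobnorm_row n m (M : 'M[R]_(n, m)) :
  frobnorm M ^+ 2 = \sum_(i < n) frobnorm (row i M) ^+ 2.
Proof.
rewrite -frobnorm_tr frobnorm_col; apply: eq_bigr => i _.
by rewrite -tr_row frobnorm_tr.
Qed.

Lemma trmx_rdiag n m (s : nat -> R) : (rdiag n m s)^T = rdiag m n s.
Proof.
by apply/matrixP => i j; rewrite !mxE eq_sym; case: eqP => // ->.
Qed.

Lemma rdiag_r_pid n m r (s : nat -> R) : rdiag_r n m r s = rdiag n m s *m pid_mx r.
Proof.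
apply/matrixP => i j; rewrite !mxE (bigD1 j) //= big1 ?addr0 => [|k kj]; last first.
  by rewrite !mxE -val_eqE /= in kj *; rewrite (negPf kj) mulr0.
rewrite !mxE eqxx /=; case: eqP => [->|]; last by rewrite mul0r.
by rewrite /=; case: (j < r)%N; rewrite ?mulr1 ?mulr0.
Qed.

Lemma svd_tr n m (M : 'M[R]_(n, m)) U s V : is_svd M U s V -> is_svd M^T V s U.
Proof.
move=> [[UU VV] s0 sdec smin ->]; split => //; first by rewrite minnC.
by rewrite !trmx_mul trmxK trmx_rdiag mulmxA.
Qed.

Lemma svd_antitone n m (M : 'M[R]_(n, m)) U s V i j :
  is_svd M U s V -> (i <= j)%N -> s j <= s i.
Proof.
move=> [_ _ sdec _ _]; elim: j => [|j IHj]; first by rewrite leqn0 => /eqP ->.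
by rewrite leq_eqVlt => /orP [/eqP ->//|/IHj]; apply: le_trans.
Qed.

(** Locked, like [svd_frame] below, lest [mulmxA] rewrite under the definition. *)
Definition svd_proj m (V : 'M[R]_m) r : 'M[R]_m := locked (V *m pid_mx r *m V^T).

Lemma hard_thr_proj n m (M : 'M[R]_(n, m)) U s V r :
  is_svd M U s V -> hard_thr r U s V = M *m svd_proj V r.
Proof.
move=> [[_ VV] _ _ _ ->].
by rewrite /hard_thr rdiag_r_pid /svd_proj -!lock !mulmxA -[_ *m V^T *m V]mulmxA VV mulmx1.
Qed.

Lemma svd_projtr m (V : 'M[R]_m) r : (svd_proj V r)^T = svd_proj V r.
Proof. by rewrite /svd_proj -!lock !trmx_mul trmxK tr_pid_mx mulmxA. Qed.

Lemma hard_thr_tr n m (U : 'M[R]_n) s (V : 'M[R]_m) r :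
  (hard_thr r U s V)^T = hard_thr r V s U.
Proof.
rewrite /hard_thr !trmx_mul trmxK mulmxA; congr (_ *m _ *m _).
by apply/matrixP => i j; rewrite !mxE eq_sym; case: eqP => // ->.
Qed.

Lemma hard_thr_projl n m (M : 'M[R]_(n, m)) U s V r :
  is_svd M U s V -> hard_thr r U s V = svd_proj U r *m M.
Proof.
move=> /svd_tr /hard_thr_proj E; rewrite -hard_thr_tr E.
by rewrite trmx_mul svd_projtr trmxK.
Qed.

(** The Gram matrix of [rdiag n m g] is diagonal with entries [g i ^+ 2]. For [n < m] the columns
    from [n] on are zero while the sum runs up to [m], hence the condition on [g]. *)
Lemma frobnorm_rdiag n m k (g : nat -> R) (Y : 'M[R]_(m, k)) :
    (forall i, (n <= i)%N -> g i = 0) ->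
  frobnorm (rdiag n m g *m Y) ^+ 2 = \sum_(i < m) g i ^+ 2 * frobnorm (row i Y) ^+ 2.
Proof.
move=> g0; rewrite frobnorm_sqr mxdot_adj mulmxA trmx_rdiag.
have -> : rdiag m n g *m rdiag n m g = diag_mx (\row_j g j ^+ 2).
  apply/matrixP => i j; rewrite !mxE.
  have [jn|nj] := ltnP j n; last first.
    rewrite big1 => [|k0 _].
      by have [->|_] := eqVneq i j; rewrite ?mulr0n // g0 // expr0n mul0rn.
    rewrite !mxE.
    by rewrite [k0 == j :> nat]ltn_eqF ?mulr0 // (leq_trans _ nj).
  rewrite (bigD1 (Ordinal jn)) //= big1 ?addr0 => [|k0 kj]; last first.
    by rewrite !mxE -val_eqE /= in kj *; rewrite (negPf kj) mulr0.
  rewrite !mxE /= eqxx -val_eqE /=.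
  by case: eqP => [->|]; rewrite ?mul0r ?expr2.
rewrite mxdotE; apply: eq_bigr => i _.
rewrite frobnorm_sqr mxdotE big_ord1 mulr_sumr; apply: eq_bigr => j _.
by rewrite mul_diag_mx !mxE mulrCA.
Qed.

(** The norm of [M W] is a sum of squared singular values weighted by the squared row norms of
    [V^T W]; the singular value estimates below come from controlling these weights. *)
Lemma svd_frobnorm_mul n m k (M : 'M[R]_(n, m)) U s V (W : 'M_(m, k)) :
    is_svd M U s V ->
  frobnorm (M *m W) ^+ 2 = \sum_(i < m) s i ^+ 2 * frobnorm (row i (V^T *m W)) ^+ 2.
Proof.
move=> [[UU _] _ _ smin ->]; rewrite -!mulmxA frobnorm_isom // frobnorm_rdiag //.
by move=> i ni; apply: smin; rewrite geq_min ni.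
Qed.

Lemma frobnorm_pid_row m k r i (Y : 'M[R]_(m, k)) :
  frobnorm (row i (pid_mx r *m Y)) ^+ 2 = (i < r)%:R * frobnorm (row i Y) ^+ 2.
Proof.
rewrite (_ : row i (pid_mx r *m Y) = (i < r)%:R *: row i Y); last first.
  apply/rowP => j; rewrite !mxE (bigD1 i) //= big1 ?addr0 => [|l li].
    by rewrite !mxE eqxx.
  by rewrite !mxE -val_eqE /= eq_sym in li *; rewrite (negPf li) mul0r.
by rewrite frobnormZ; case: ltnP; rewrite ?normr1 ?normr0 ?mul1r ?mul0r ?expr0n.
Qed.

Lemma row_copid_eq0 m k r (i : 'I_m) (Y : 'M[R]_(m, k)) :
  copid_mx r *m Y = 0 -> (r <= i)%N -> row i Y = 0.
Proof.
rewrite /copid_mx mulmxBl mul1mx => /eqP; rewrite subr_eq0 => /eqP -> ri.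
apply: frobnorm_eq0; apply/eqP; rewrite -sqrf_eq0 frobnorm_pid_row.
by rewrite ltnNge ri mul0r.
Qed.

(** Since [M - M_r = M (1 - Q)] and [1 - Q] deletes the first [r] rows of [V^T W], the terms below
    [r] drop out. *)
Lemma svd_tail_frobnorm_mul n m k (M : 'M[R]_(n, m)) U s V r (W : 'M_(m, k)) :
    is_svd M U s V ->
  frobnorm ((M - hard_thr r U s V) *m W) ^+ 2 =
    \sum_(i < m | (r <= i)%N) s i ^+ 2 * frobnorm (row i (V^T *m W)) ^+ 2.
Proof.
move=> sM; rewrite (hard_thr_proj r sM).
rewrite (_ : (M - _) *m W = M *m (W - svd_proj V r *m W)); last first.
  by rewrite mulmxBl mulmxBr (mulmxA M _ W).
rewrite (svd_frobnorm_mul _ sM) [RHS]big_mkcond; apply: eq_bigr => i _.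
have [[_ VV] _ _ _ _] := sM.
rewrite mulmxBr /svd_proj -!lock !mulmxA VV mul1mx -!mulmxA.
have -> : V^T *m W - pid_mx r *m (V^T *m W) = copid_mx r *m (V^T *m W).
  by rewrite /copid_mx mulmxBl mul1mx.
have -> : row i (copid_mx r *m (V^T *m W)) = (r <= i)%:R *: row i (V^T *m W).
  apply/rowP => j; rewrite !mxE (bigD1 i) //= big1 ?addr0 => [|l li].
    by rewrite !mxE !eqxx ltnNge; case: (r <= i)%N; rewrite /= ?subrr ?subr0 ?mul0r ?mul1r.
  rewrite !mxE -!val_eqE /= eq_sym in li *.
  by rewrite (negPf li) subrr mul0r.
rewrite frobnormZ; case: leqP; rewrite ?normr1 ?normr0 ?mul1r ?mul0r ?expr0n ?mulr0 //.
Qed.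

Lemma sum_rows_orthogonal m k (V : 'M[R]_m) (W : 'M[R]_(m, k)) : V^T *m V = 1%:M ->
  \sum_(i < m) frobnorm (row i (V^T *m W)) ^+ 2 = frobnorm W ^+ 2.
Proof.
by move=> /mulmx1C VV; rewrite -frobnorm_row frobnorm_isom // trmxK.
Qed.

Lemma frobnorm_delta m (i : 'I_m) : frobnorm (delta_mx i 0 : 'cV[R]_m) = 1.
Proof.
rewrite /frobnorm (bigD1 i) //= big_ord1 !mxE !eqxx expr1n big1 ?addr0 ?sqrtr1 //.
by move=> j ji; rewrite big_ord1 !mxE (negPf ji) expr0n.
Qed.

Lemma row_orthogonal_le m k (V : 'M[R]_m) (W : 'M[R]_(m, k)) c i :
    V^T *m V = 1%:M -> opbound W^T c -> frobnorm (row i (V^T *m W)) <= c.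
Proof.
move=> VV Wc; rewrite -frobnorm_tr tr_row trmx_mul trmxK colE -mulmxA.
apply: le_trans (Wc _) _; rewrite frobnorm_isom //.
by rewrite frobnorm_delta mulr1.
Qed.

(** * Weyl inequalities *)

(** The sum is compared with the threshold [f (o + r)]: [f k <= l k + t max (f - l, 0)]. *)
Lemma weighted_sum_le m r o (f : nat -> R) (k : 'I_m -> R) t :
    0 <= t -> (forall i, 0 <= f i) -> (forall i j, (i <= j)%N -> f j <= f i) ->
    (forall i, 0 <= k i <= t) -> \sum_(i < m) k i <= t * r%:R ->
  \sum_(i < m | (o <= i)%N) f i * k i <= t * \sum_(j < r) f (o + j)%N.
Proof.
move=> t0 f0 fdec kt ksum; set l := f (o + r)%N.
pose h i := Num.max (f i - l) 0.
have h0 i : 0 <= h i by rewrite le_max lexx orbT.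
have hsum : \sum_(i < m | (o <= i)%N) h i <= \sum_(j < r) (f (o + j)%N - l).
  (* The range up to [maxn m (o + r)] treats [m] below and above [o + r] at once; from [o + r] on,
     [h] vanishes by monotonicity. *)
  apply: (@le_trans _ _ (\sum_(0 <= i < maxn m (o + r) | (o <= i)%N) h i)).
    rewrite -(big_mkord (fun i => o <= i)%N h) (big_cat_nat (leq0n m) (leq_maxl _ _)) //=.
    by rewrite lerDl sumr_ge0.
  rewrite (big_cat_nat (leq0n (o + r)) (leq_maxr _ _)) //=.
  rewrite [X in _ + X]big_nat_cond [X in _ + X]big1 ?addr0 => [|i /andP[/andP[oi _] _]]; last first.
    by apply/max_idPr; rewrite subr_le0 fdec.
  have -> : \sum_(0 <= i < o + r | (o <= i)%N) h i = \sum_(j < r) h (j + o)%N.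
    rewrite -(big_mkord xpredT (fun j => h (j + o)%N)) -{2}(addKn o r).
    transitivity (\sum_(o <= i < o + r) h i); first by rewrite [RHS](big_nat_widenl o 0).
    by rewrite -{1}[o]add0n big_addn.
  apply: ler_sum => i _; rewrite addnC /h ge_max lexx subr_ge0 fdec //.
  by rewrite leq_add2l ltnW.
apply: (@le_trans _ _ (\sum_(i < m | (o <= i)%N) (l * k i + t * h i))).
  apply: ler_sum => i _; have /andP[k0 k1] := kt i.
  have : f i - l <= h i by rewrite le_max lexx.
  move: (h i) (h0 i) => hi hi0 H.
  have : (f i - l) * k i <= hi * k i by rewrite ler_wpM2r.
  have : hi * k i <= hi * t by rewrite ler_wpM2l.
  by lra.
rewrite big_split /= -!mulr_sumr.
have ks : \sum_(i < m | (o <= i)%N) k i <= t * r%:R.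
  apply: le_trans ksum; rewrite [leRHS](bigID (fun i : 'I_m => (o <= i)%N)) /= lerDl.
  by apply: sumr_ge0 => i _; have /andP[] := kt i.
have {}hsum : t * \sum_(i < m | (o <= i)%N) h i <= t * (\sum_(j < r) f (o + j)%N - l * r%:R).
  rewrite ler_wpM2l // (le_trans hsum) // sumrB sumr_const card_ord.
  by rewrite -[l *+ r]mulr_natr.
have : l * \sum_(i < m | (o <= i)%N) k i <= l * (t * r%:R) by rewrite ler_wpM2l ?f0.
lra.
Qed.

(** Put [N = min (2 r, m)]. Weights in [0, 1] of total [N - r], none from [2 r] on, give the least
    sum when they fill the indices [r, ..., N - 1]. Each term is compared with the threshold [f r];
    [h] is the shortfall [f r - f i] at those indices. *)
Lemma weighted_sum_ge m r (f : nat -> R) (k : 'I_m -> R) :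
    (r <= m)%N -> (forall i j, (i <= j)%N -> f j <= f i) ->
    (forall i, (m <= i)%N -> f i = 0) ->
    (forall i, 0 <= k i <= 1) -> (forall i : 'I_m, (r + r <= i)%N -> k i = 0) ->
    \sum_(i < m) k i = (minn (r + r) m - r)%:R ->
  \sum_(j < r) f (r + j)%N <= \sum_(i < m) f i * k i.
Proof.
move=> rm fdec fm k01 kr ksum; set N := minn _ _ in ksum.
have rN : (r <= N)%N by rewrite leq_min leq_addr.
have Nm : (N <= m)%N by rewrite geq_minr.
pose h i := if (r <= i < N)%N then f r - f i else 0.
have hsum : \sum_(i < m) h i = f r * (N - r)%:R - \sum_(r <= i < N) f i.
  rewrite -(big_mkord xpredT h) (big_cat_nat (leq0n r) rm) //=.
  rewrite (big_cat_nat rN Nm) //= [X in X + _]big_nat_cond [X in X + _]big1; last first.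
    by move=> i /andP[/andP[_ ir] _]; rewrite /h leqNgt ir.
  rewrite add0r [X in _ + X]big_nat_cond [X in _ + X]big1 ?addr0; last first.
    by move=> i /andP[/andP[Ni _] _]; rewrite /h [(i < N)%N]ltnNge Ni andbF.
  rewrite -sumr_const_nat mulr_sumr -sumrB big_nat_cond [RHS]big_nat_cond.
  by apply: eq_bigr => i /andP[rNi _]; rewrite /h rNi mulr1.
have -> : \sum_(j < r) f (r + j)%N = \sum_(r <= i < N) f i.
  transitivity (\sum_(r <= i < r + r) f i).
    rewrite -[X in index_iota X]add0n big_addn addnK big_mkord.
    by apply: eq_bigr => i _; rewrite addnC.
  rewrite (big_cat_nat rN (geq_minl _ _)) //= [X in _ + X]big_nat_cond [X in _ + X]big1 ?addr0 //.
  move=> i /andP[/andP[]]; rewrite /N geq_min => /orP[ri ir|mi _] _; last exact: fm.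
  by move: ir; rewrite ltnNge ri.
suff : \sum_(i < m) f r * k i <= \sum_(i < m) (f i * k i + h i).
  by rewrite big_split /= hsum -mulr_sumr ksum; lra.
apply: ler_sum => i _; have /andP[k0 k1] := k01 i; rewrite /h.
case: ifP => [/andP[ri _]|]; last first.
  move=> /negbT; rewrite negb_and -!ltnNge addr0 => /orP[ir|].
    by rewrite ler_wpM2r // fdec // ltnW.
  rewrite ltnS geq_min [(m <= i)%N]leqNgt ltn_ord orbF => /kr ->.
  by rewrite !mulr0.
have : f i <= f r by exact: fdec.
move: (f i) (f r) (k i) k0 k1 => a b c c0 c1 ab.
have : (b - a) * c <= (b - a) * 1 by rewrite ler_wpM2l // subr_ge0.
by lra.
Qed.

(** Each row of [V^T W] has norm at most [c] and the squares add up to at most [c^2 r], so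
    [weighted_sum_le] applies with [t = c^2]. Offset [o = r] serves the tails after truncation,
    [o = 0] the whole matrix. *)
Lemma svd_tail_le n m k (M : 'M[R]_(n, m)) U s V r o (W : 'M_(m, k)) c :
    is_svd M U s V -> 0 <= c -> opbound W^T c -> frobnorm W ^+ 2 <= c ^+ 2 * r%:R ->
  frobnorm ((M - hard_thr o U s V) *m W) <=
    c * Num.sqrt (\sum_(j < r) s (o + j)%N ^+ 2).
Proof.
move=> sM c0 Wc Wr; have [[_ VV] s0 _ _ _] := sM.
rewrite -(@ler_pXn2r _ 2) ?nnegrE ?mulr_ge0 ?sqrtr_ge0 ?frobnorm_ge0 //.
rewrite exprMn [X in _ <= _ * X]sqr_sqrtr; last by apply: sumr_ge0 => j _; exact: sqr_ge0.
rewrite (svd_tail_frobnorm_mul _ _ sM).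
apply: (@weighted_sum_le _ _ _ (fun i => s i ^+ 2)) => [|i|i j ij|i|].
- exact: sqr_ge0.
- exact: sqr_ge0.
- by rewrite ler_pXn2r ?nnegrE ?s0 // (svd_antitone sM).
- rewrite sqr_ge0 ler_pXn2r ?nnegrE ?frobnorm_ge0 //; exact: row_orthogonal_le.
- by rewrite sum_rows_orthogonal.
Qed.

(** The case of a single column [x]: [r = 1] and [c = |x|]. *)
Lemma svd_tail_opbound n m (M : 'M[R]_(n, m)) U s V o :
  is_svd M U s V -> opbound (M - hard_thr o U s V) (s o).
Proof.
move=> sM x; have [[_ VV] s0 _ _ _] := sM.
have xb : opbound x^T (frobnorm x).
  by rewrite -frobnorm_tr; exact: opbound_frobnorm.
have := @svd_tail_le _ _ _ _ _ _ _ 1 o _ _ sM (frobnorm_ge0 x) xb.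
by rewrite mulr1 big_ord1 addn0 sqrtr_sqr ger0_norm // mulrC; apply.
Qed.

Lemma hard_thr0 n m (U : 'M[R]_n) s (V : 'M[R]_m) : hard_thr 0 U s V = 0.
Proof. by rewrite /hard_thr rdiag_r_pid pid_mx_0 mulmx0 mulmx0 mul0mx. Qed.

Lemma svd_head_ge n m (M : 'M[R]_(n, m)) U s V k (x : 'cV_m) :
    is_svd M U s V -> copid_mx k.+1 *m (V^T *m x) = 0 ->
  s k * frobnorm x <= frobnorm (M *m x).
Proof.
move=> sM xk; have [[_ VV] s0 _ _ _] := sM.
rewrite -(@ler_pXn2r _ 2) ?nnegrE ?mulr_ge0 ?frobnorm_ge0 //.
rewrite exprMn (svd_frobnorm_mul _ sM) -(sum_rows_orthogonal _ VV) mulr_sumr.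
apply: ler_sum => i _; have [ik|ki] := leqP i k.
  by rewrite ler_wpM2r ?sqr_ge0 // ler_pXn2r ?nnegrE ?s0 // (svd_antitone sM).
by rewrite (row_copid_eq0 xk ki) frobnorm0 expr0n !mulr0.
Qed.

(** The first [k] right singular vectors of [M'] and those of [M] after the first [k + 1] span at
    most [m - 1] dimensions, so some unit [W] is orthogonal to all of them. Then [s k <= |M W| <=
    |(M' - M'_k) W| + |(M - M') W| <= s' k + e]. *)
Lemma weyl_svd n m (M M' : 'M[R]_(n, m)) U s V U' s' V' e k :
    is_svd M U s V -> is_svd M' U' s' V' -> 0 <= e -> opbound (M - M') e ->
  s k <= s' k + e.
Proof.
move=> sM sM' e0 Me; have [_ _ _ smin _] := sM; have [[_ VV'] s'0 _ _ _] := sM'.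
have [/smin ->|km] := leqP (minn n m) k; first by rewrite addr_ge0.
pose G := col_mx (pid_mx k *m V'^T : 'M_m) (copid_mx k.+1 *m V^T).
have [|W W1 GW] := @orthonormal_kernel _ _ 1 G.
  rewrite -addsmxE.
  apply: leq_trans (leq_add (mxrank_adds_leqif _ _) (leqnn 1)) _.
  apply: leq_trans (leq_add (leq_add (mxrankM_maxl _ _) (mxrankM_maxl _ _)) (leqnn 1)) _.
  rewrite rank_pid_mx ?rank_copid_mx; lia.
have {W1} W1 : frobnorm W = 1.
  by apply/eqP; rewrite -(@eqrXn2 _ 2) ?frobnorm_ge0 // frobnorm_orthonormal // expr1n.
move: GW; rewrite mul_col_mx -col_mx0 -!mulmxA => /eq_col_mx [W'0 W0].
have := svd_head_ge sM W0; rewrite W1 mulr1 => /le_trans; apply.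
have -> : M *m W = (M' - hard_thr k U' s' V') *m W + (M - M') *m W.
  rewrite (hard_thr_proj k sM') !mulmxBl.
  by rewrite -(mulmxA M') /svd_proj -!lock -!mulmxA W'0 !mulmx0 subr0 addrC subrK.
apply: le_trans (frobnormD _ _) _; apply: lerD.
  by have := svd_tail_opbound k sM' W; rewrite W1 mulr1.
by have := Me W; rewrite W1 mulr1.
Qed.

(** The same count with [N - r] orthonormal columns, [N = min (2 r, m)]: [W] is orthogonal to the
    first [r] right singular vectors of [A] and to those of [A + E] after the first [N]. By
    [weighted_sum_ge] the norm of [(A + E) W] is at least the left-hand side, and
    [(A + E) W = (A - A_r) W + E W] bounds it from above. *)
Lemma svd_tail_sum_le n m r (A E : 'M[R]_(n, m)) U s V Ut st Vt UE sE VE :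
    (r <= m)%N -> is_svd A U s V -> is_svd (A + E) Ut st Vt -> is_svd E UE sE VE ->
  Num.sqrt (\sum_(j < r) st (r + j)%N ^+ 2) <=
    Num.sqrt (\sum_(j < r) s (r + j)%N ^+ 2) + Num.sqrt (\sum_(j < r) sE j ^+ 2).
Proof.
move=> rm sA sAt sE'; pose N := minn (r + r) m.
have rN : (r <= N)%N by rewrite leq_min leq_addr.
have Nm : (N <= m)%N by rewrite geq_minr.
pose G := col_mx (pid_mx r *m V^T : 'M_m) (copid_mx N *m Vt^T).
have [|W W1] := @orthonormal_kernel _ _ (N - r) G.
  rewrite -addsmxE.
  apply: leq_trans (leq_add (mxrank_adds_leqif _ _) (leqnn _)) _.
  apply: leq_trans (leq_add (leq_add (mxrankM_maxl _ _) (mxrankM_maxl _ _)) (leqnn _)) _.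
  rewrite rank_pid_mx ?rank_copid_mx; lia.
rewrite mul_col_mx -col_mx0 -!mulmxA => /eq_col_mx [VW VtW].
have Wop : opbound W^T 1.
  apply: opbound_tr => // x; by rewrite frobnorm_isom // mul1r.
have Wr : frobnorm W ^+ 2 <= 1 ^+ 2 * r%:R.
  by rewrite frobnorm_orthonormal // expr1n mul1r ler_nat /N; lia.
have [[_ VtVt] st0 _ stmin _] := sAt.
apply: (@le_trans _ _ (frobnorm ((A + E) *m W))).
  rewrite -[leRHS]ger0_norm ?frobnorm_ge0 // -sqrtr_sqr ler_wsqrtr //.
  rewrite (svd_frobnorm_mul _ sAt).
  apply: (@weighted_sum_ge _ _ (fun i => st i ^+ 2)) => // [i j ij|i mi|i|i|].
  - by rewrite ler_pXn2r ?nnegrE // (svd_antitone sAt).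
  - by rewrite stmin ?expr0n // geq_min mi orbT.
  - rewrite sqr_ge0 -(expr1n R 2) ler_pXn2r ?nnegrE ?frobnorm_ge0 //.
    exact: row_orthogonal_le.
  - by move=> ri; rewrite (row_copid_eq0 VtW) ?frobnorm0 ?expr0n // geq_min ri.
  - by rewrite sum_rows_orthogonal // frobnorm_orthonormal.
have -> : (A + E) *m W = (A - hard_thr r U s V) *m W + (E - hard_thr 0 UE sE VE) *m W.
  rewrite hard_thr0 subr0 (hard_thr_proj r sA) mulmxDl mulmxBl -(mulmxA A _ W).
  by rewrite /svd_proj -!lock -!mulmxA VW !mulmx0 subr0.
apply: le_trans (frobnormD _ _) _; apply: lerD.
  by have := svd_tail_le r sA ler01 Wop Wr; rewrite mul1r.
by have := svd_tail_le 0 sE' ler01 Wop Wr; rewrite mul1r.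
Qed.

(** * Principal angles *)

(** Stated on row vectors, where the extreme value theorem [EVT_min_rV] applies. *)
Lemma continuous_sqnorm_mulmx n r (G : 'M[R]_(n, r)) :
  continuous (fun x : 'rV[R]_r => mxdot (G *m x^T) (G *m x^T)).
Proof.
have -> : (fun x : 'rV[R]_r => mxdot (G *m x^T) (G *m x^T)) =
    (fun x : 'rV[R]_r => \sum_(i < n) (\sum_(j < r) G i j * x 0 j) ^+ 2).
  apply: boolp.funext => x; rewrite mxdotE; apply: eq_bigr => i _.
  by rewrite big_ord1 -expr2 !mxE; congr (_ ^+ 2); apply: eq_bigr => j _; rewrite mxE.
apply: continuous_big => [|i _ x]; first exact: add_continuous.
have sumc : continuous (fun y : 'rV[R]_r => \sum_(j < r) G i j * y 0 j).
  apply: continuous_big => [|j _ y]; first exact: add_continuous.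
  apply: (continuous_comp (f := fun y : 'rV[R]_r => y 0 j)); first exact: coord_continuous.
  exact: mulrl_continuous.
apply: (continuous_comp (g := fun z : R => z ^+ 2)); first exact: sumc.
exact: exprn_continuous.
Qed.

Lemma least_stretched_unit_vector n r (G : 'M[R]_(n, r)) : (0 < r)%N ->
  exists2 x : 'cV[R]_r, frobnorm x = 1 &
    forall v : 'cV_r, frobnorm (G *m x) * frobnorm v <= frobnorm (G *m v).
Proof.
(* The factor [1%:M] gives the unit sphere the form of [continuous_sqnorm_mulmx], which then shows
   that it is closed. *)
move=> r0; pose S := [set x : 'rV[R]_r | mxdot (1%:M *m x^T) (1%:M *m x^T) = 1]%classic.
have S0 : (S !=set0)%classic.
  exists (delta_mx 0 (Ordinal r0)); rewrite /S /= mul1mx mxdotE (bigD1 (Ordinal r0)) //=.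
  rewrite big_ord1 !mxE !eqxx mulr1 big1 ?addr0 // => i /negPf i0.
  by rewrite big_ord1 !mxE !eqxx i0 /= mulr0.
have Scl : closed S.
  have := @continuous_sqnorm_mulmx r r 1%:M => /continuous_closedP /(_ [set 1]%classic).
  apply; exact: closed_eq.
have Sbd : bounded_set S.
  exists 1; split; first exact: num_real.
  move=> M M1 x; rewrite /S /= mul1mx mxdotE => x1.
  rewrite [X in X <= _]/Num.Def.normr /= mx_normrE.
  apply/bigmax_leP; split; first by rewrite (le_trans _ (ltW M1)).
  move=> [i j] _ /=; rewrite (le_trans _ (ltW M1)) //.
  rewrite -(@ler_pXn2r _ 2) ?nnegrE ?normr_ge0 // real_normK ?num_real // expr1n -x1.
  rewrite (bigD1 j) //= big_ord1 !mxE (ord1 i) -expr2 lerDl sumr_ge0 // => k _.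
  by apply: sumr_ge0 => l _; rewrite -expr2 sqr_ge0.
have [x xS xmin] := EVT_min_rV S0 (bounded_closed_compact Sbd Scl)
  (continuous_subspaceT (@continuous_sqnorm_mulmx n r G)).
have {}xS : frobnorm x^T = 1.
  by move: xS; rewrite inE /S /= mul1mx frobnormE => ->; rewrite sqrtr1.
exists x^T => // v; have [->|v0] := eqVneq (frobnorm v) 0.
  by rewrite mulr0 frobnorm_ge0.
have p0 : 0 < frobnorm v by rewrite lt_def v0 frobnorm_ge0.
pose w := (frobnorm v)^-1 *: v.
have w1 : frobnorm w = 1.
  by rewrite frobnormZ ger0_norm ?invr_ge0 ?frobnorm_ge0 // mulVf.
have vE : v = frobnorm v *: w by rewrite scalerA mulfV // scale1r.
rewrite [in leRHS]vE -scalemxAr frobnormZ ger0_norm ?frobnorm_ge0 // mulrC ler_pM2l //.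
rewrite -(@ler_pXn2r _ 2) ?nnegrE ?frobnorm_ge0 // !frobnorm_sqr.
have := xmin w^T; rewrite trmxK; apply.
by rewrite inE /S /= trmxK mul1mx -frobnorm_sqr w1 expr1n.
Qed.

(** [phi v = |G v|^2 - c^2 |v|^2] is nonnegative and vanishes at [x], and [d] is half its gradient
    there. If [d] were nonzero, a small step against it would make [phi] negative. *)
Lemma least_stretched_eigen n r (G : 'M[R]_(n, r)) (x : 'cV_r) c :
    frobnorm x = 1 -> frobnorm (G *m x) = c ->
    (forall v : 'cV_r, c * frobnorm v <= frobnorm (G *m v)) ->
  G^T *m (G *m x) = c ^+ 2 *: x.
Proof.
move=> x1 Gx Gmin; have [d dE] : exists d, d = G^T *m (G *m x) - c ^+ 2 *: x by eexists.
have c0 : 0 <= c by rewrite -Gx frobnorm_ge0.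
apply/eqP; rewrite -subr_eq0 -dE; apply/eqP/frobnorm_eq0.
pose phi (v : 'cV_r) := frobnorm (G *m v) ^+ 2 - c ^+ 2 * frobnorm v ^+ 2.
have phi0 v : 0 <= phi v.
  by rewrite subr_ge0 -exprMn ler_pXn2r ?nnegrE ?mulr_ge0 ?frobnorm_ge0.
have line t : phi (x + t *: d) = t * (2 * mxdot d d + t * phi d).
  have -> : 2 * mxdot d d = 2 * (mxdot (G *m x) (G *m d) - c ^+ 2 * mxdot x d).
    rewrite {1}dE mxdotDl mxdotNl mxdotZl; congr (_ * (_ - _)).
    by rewrite mxdot_adj trmxK.
  rewrite /phi mulmxDr -scalemxAr !frobnorm_sqr !mxdotDl !mxdotDr !mxdotZl !mxdotZr.
  rewrite -!(frobnorm_sqr x) -!(frobnorm_sqr (G *m x)) x1 Gx.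
  rewrite (mxdotC (G *m d) (G *m x)) (mxdotC d x); ring.
have dd0 := mxdot_ge0 d; have pd0 := phi0 d.
suff : mxdot d d <= 0.
  by rewrite frobnormE => H; rewrite (ler0_sqrtr H).
rewrite leNgt; apply/negP => dpos.
(* Short enough that [2 |d|^2 + t (phi d) >= |d|^2]; the [+ 1] keeps the denominator positive. *)
pose t := - (mxdot d d / (phi d + 1)).
have := phi0 (x + t *: d); rewrite line.
have p1 : 0 < phi d + 1 by rewrite ltr_wpDl.
have tneg : t < 0 by rewrite oppr_lt0 divr_gt0.
rewrite nmulr_rge0 // => H.
have : t * phi d >= - mxdot d d.
  rewrite mulNr lerN2 -mulrA ler_piMr // mulrC ler_pdivrMr // mul1r; lra.
lra.
Qed.

Lemma mxdot_pythagoras n m (M N : 'M[R]_(n, m)) a b : mxdot M N = 0 ->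
  frobnorm (a *: M + b *: N) ^+ 2 = a ^+ 2 * frobnorm M ^+ 2 + b ^+ 2 * frobnorm N ^+ 2.
Proof.
move=> MN; rewrite !frobnorm_sqr !mxdotDl !mxdotDr !mxdotZl !mxdotZr (mxdotC N M) MN; ring.
Qed.

(** For nonzero [c] take [y = c^-1 G x]. For [c = 0] the square matrix [G] is singular, so [G^T]
    kills some unit vector, and any such [y] serves. *)
Lemma singular_pair r (G : 'M[R]_r) (x : 'cV_r) c :
    frobnorm x = 1 -> frobnorm (G *m x) = c -> G^T *m (G *m x) = c ^+ 2 *: x ->
  exists2 y : 'cV_r, frobnorm y = 1 & G *m x = c *: y /\ G^T *m y = c *: x.
Proof.
move=> x1 Gx GGx; have [c0|c0] := eqVneq c 0; last first.
  exists (c^-1 *: (G *m x)).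
    by rewrite frobnormZ Gx ger0_norm ?mulVf // invr_ge0 -Gx frobnorm_ge0.
  split; first by rewrite scalerA mulfV // scale1r.
  by rewrite -scalemxAr GGx scalerA expr2 mulKf.
rewrite c0 in Gx *; have Gx0 := frobnorm_eq0 Gx.
have [|y y1 Gy] := @orthonormal_kernel _ _ 1 G^T.
  rewrite addn1 ltn_neqAle rank_leq_row andbT; apply/negP => /row_free_inj inj.
  have : x^T = 0 by apply: inj; rewrite /= -trmx_mul Gx0 trmx0 mul0mx.
  move=> /(congr1 trmx); rewrite trmxK trmx0 => x0.
  by move/eqP: x1; rewrite x0 frobnorm0 eq_sym oner_eq0.
exists y; last by rewrite Gx0 Gy !scale0r.
by apply/eqP; rewrite -(@eqrXn2 _ 2) ?frobnorm_ge0 // frobnorm_orthonormal // expr1n.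
Qed.

(** For the largest principal angle take unit [p] in range [V], [q] orthogonal to
    range [V], [z] in range [Vt], [w] orthogonal to range [Vt] with [p = c z + s w] and
    [q = - s z + c w].  As [|At z| >= |At w|], an angle above 45 degrees would give
    [|At p| <= |At q|], hence [a - b <= |A p| - |A q| <= 2 e].  Below, [q] and [w] are
    not normalised: both have norm [sn = s]. *)
Lemma gap_angle n m r (A At : 'M[R]_(n, m)) (V Vt : 'M_(m, r)) a b t e :
    (0 < r)%N -> V^T *m V = 1%:M -> Vt^T *m Vt = 1%:M -> 0 <= t ->
    (forall y : 'cV_r, a * frobnorm y <= frobnorm (A *m (V *m y))) ->
    (forall q : 'cV_m, V^T *m q = 0 -> frobnorm (A *m q) <= b * frobnorm q) ->
    (forall y : 'cV_r, t * frobnorm y <= frobnorm (At *m (Vt *m y))) ->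
    (forall w : 'cV_m, Vt^T *m w = 0 -> frobnorm (At *m w) <= t * frobnorm w) ->
    (forall (y : 'cV_r) (w : 'cV_m), Vt^T *m w = 0 ->
      mxdot (At *m (Vt *m y)) (At *m w) = 0) ->
    opbound (A - At) e -> b + 2 * e < a ->
  forall x : 'cV_r, frobnorm x ^+ 2 <= 2 * frobnorm (Vt^T *m (V *m x)) ^+ 2.
Proof.
move=> r0 VV VtVt t0 Age Ale Atge Atle Atorth Ae gap x0.
have [x x1 xmin] := least_stretched_unit_vector (Vt^T *m V) r0.
have [c cE] : exists c, frobnorm (Vt^T *m V *m x) = c by eexists.
rewrite cE in xmin; have c0 : 0 <= c by rewrite -cE frobnorm_ge0.
(* [c] is the cosine of the largest principal angle; if [2 c^2 >= 1], minimality of [x] gives the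
   claim for every vector. *)
have [c12|c12] := lerP 1 (2 * c ^+ 2).
  have := xmin x0; rewrite -mulmxA -(@ler_pXn2r _ 2) ?nnegrE ?mulr_ge0 ?frobnorm_ge0 //.
  rewrite exprMn; have := sqr_ge0 (frobnorm x0); move: (frobnorm x0 ^+ 2) => u u0 H.
  have : 1 * u <= 2 * c ^+ 2 * u by rewrite ler_wpM2r.
  by lra.
exfalso; have [y y1 []] := singular_pair x1 cE (least_stretched_eigen x1 cE xmin).
rewrite trmx_mul trmxK -!mulmxA => Gx Gy.
pose p := V *m x; pose z := Vt *m y; pose q := c *: p - z; pose w := p - c *: z.
have p1 : frobnorm p = 1 by rewrite frobnorm_isom.
have z1 : frobnorm z = 1 by rewrite frobnorm_isom.
have Vtw : Vt^T *m w = 0.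
  by rewrite mulmxBr -scalemxAr Gx /z (mulmxA Vt^T) VtVt mul1mx subrr.
have Vq : V^T *m q = 0.
  by rewrite mulmxBr -scalemxAr Gy /p (mulmxA V^T) VV mul1mx subrr.
have zp : mxdot p z = c.
  rewrite mxdotC mxdot_adj Gx mxdotZr -frobnorm_sqr y1; ring.
have qn : frobnorm q ^+ 2 = 1 - c ^+ 2.
  rewrite frobnorm_sqr mxdotDl !mxdotDr !mxdotNl !mxdotNr !mxdotZl !mxdotZr.
  rewrite (mxdotC z p) -!frobnorm_sqr p1 z1 zp; ring.
have wn : frobnorm w ^+ 2 = 1 - c ^+ 2.
  rewrite frobnorm_sqr mxdotDl !mxdotDr !mxdotNl !mxdotNr !mxdotZl !mxdotZr.
  rewrite (mxdotC z p) -!frobnorm_sqr p1 z1 zp; ring.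
have [sn snE] : exists sn, frobnorm q = sn by eexists.
have wsn : frobnorm w = sn.
  by apply/eqP; rewrite -(@eqrXn2 _ 2) -?snE ?frobnorm_ge0 // wn qn.
have sn0 : 0 <= sn by rewrite -snE frobnorm_ge0.
rewrite snE in qn.
have AtpE : At *m p = c *: (At *m z) + 1 *: (At *m w).
  by rewrite scale1r scalemxAr -mulmxDr addrC subrK.
have AtqE : At *m q = (- sn ^+ 2) *: (At *m z) + c *: (At *m w).
  rewrite !(scalemxAr _ At) -mulmxDr; congr (_ *m _).
  by apply/matrixP => i j; rewrite qn !mxE; ring.
have Atp := mxdot_pythagoras c 1 (Atorth y w Vtw).
have Atq := mxdot_pythagoras (- sn ^+ 2) c (Atorth y w Vtw).
rewrite -AtpE in Atp; rewrite -AtqE in Atq.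
have pq : sn * frobnorm (At *m p) <= frobnorm (At *m q).
  rewrite -(@ler_pXn2r _ 2) ?nnegrE ?mulr_ge0 ?frobnorm_ge0 // exprMn Atp Atq.
  have Z : t ^+ 2 <= frobnorm (At *m z) ^+ 2.
    by rewrite ler_pXn2r ?nnegrE ?frobnorm_ge0 //; have := Atge y; rewrite y1 mulr1.
  have W : frobnorm (At *m w) ^+ 2 <= t ^+ 2 * sn ^+ 2.
    by rewrite -exprMn ler_pXn2r ?nnegrE ?mulr_ge0 ?frobnorm_ge0 // -wsn Atle.
  move: (frobnorm (At *m z) ^+ 2) (frobnorm (At *m w) ^+ 2) Z W => Z W Zt Wt.
  have sc : 0 <= sn ^+ 2 - c ^+ 2 by rewrite qn; lra.
  have : W <= Z * sn ^+ 2 by apply: le_trans Wt _; rewrite ler_wpM2r ?sqr_ge0.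
  move: (sn ^+ 2) (c ^+ 2) sc => S C sc H.
  (* With [Z = |At z|^2] and [W = |At w|^2], this product is exactly [|At q|^2 - sn^2 |At p|^2]; its
     first factor is [1 - 2 c^2], positive for an angle above 45 degrees. *)
  have : 0 <= (S - C) * (Z * S - W) by rewrite mulr_ge0 // subr_ge0.
  lra.
have H1 : a <= frobnorm (At *m p) + e.
  have := Age x; rewrite x1 mulr1 => /le_trans; apply.
  have -> : A *m p = At *m p + (A - At) *m p by rewrite mulmxBl addrC subrK.
  apply: le_trans (frobnormD _ _) _; rewrite lerD2l.
  by have := Ae p; rewrite p1 mulr1.
have H2 : frobnorm (At *m q) <= b * sn + e * sn.
  have -> : At *m q = A *m q - (A - At) *m q by rewrite mulmxBl subKr.
  apply: le_trans (frobnormB _ _) _; apply: lerD; first by rewrite -snE Ale.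
  by rewrite -snE Ae.
have sp : 0 < sn by rewrite lt_def sn0 andbT -sqrf_eq0 qn; apply/eqP; lra.
(* The chain is [sn a <= sn |At p| + sn e <= |At q| + sn e <= sn (b + 2 e)], which contradicts the
   gap as [sn > 0]. *)
have : sn * a <= sn * (b + 2 * e).
  have : sn * a <= sn * (frobnorm (At *m p) + e) by rewrite ler_wpM2l.
  lra.
by rewrite ler_pM2l // leNgt gap.
Qed.

(** * Perturbation of singular subspaces *)

Definition orthoproj m (Q : 'M[R]_m) := Q^T = Q /\ Q *m Q = Q.

Lemma orthoprojC m (Q : 'M[R]_m) : orthoproj Q -> orthoproj (1%:M - Q).
Proof.
move=> [QT QQ]; split; first by rewrite linearB /= trmx1 QT.
by rewrite mulmxBl mul1mx mulmxBr mulmx1 QQ subrr subr0.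
Qed.

Lemma orthoproj_opbound m (Q : 'M[R]_m) : orthoproj Q -> opbound Q 1.
Proof.
move=> [QT QQ] x; rewrite mul1r; have [->|N0] := eqVneq (frobnorm (Q *m x)) 0.
  exact: frobnorm_ge0.
have p0 : 0 < frobnorm (Q *m x) by rewrite lt_def N0 frobnorm_ge0.
rewrite -(ler_pM2l p0) -expr2 frobnorm_sqr mxdot_adj QT mulmxA QQ mulrC.
exact: mxdot_le.
Qed.

Lemma orthoproj_le m k (Q : 'M[R]_m) (X : 'M_(m, k)) :
  orthoproj Q -> frobnorm (Q *m X) <= frobnorm X.
Proof. by move=> /orthoproj_opbound Q1; rewrite -[leRHS]mul1r opbound_mx. Qed.

Lemma orthoproj_ler m k (Q : 'M[R]_m) (X : 'M_(k, m)) :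
  orthoproj Q -> frobnorm (X *m Q) <= frobnorm X.
Proof.
move=> Qp; rewrite -frobnorm_tr -[leRHS]frobnorm_tr trmx_mul.
by have [-> _] := Qp; exact: orthoproj_le.
Qed.

Lemma orthoproj_pythagoras m k (Q : 'M[R]_m) (X : 'M_(m, k)) : orthoproj Q ->
  frobnorm X ^+ 2 = frobnorm (Q *m X) ^+ 2 + frobnorm ((1%:M - Q) *m X) ^+ 2.
Proof.
move=> Qp; have [QT QQ] := Qp.
rewrite -[in LHS](subrK (Q *m X) X) addrC -[in LHS](mul1mx X) mulmxA mulmx1 -mulmxBl.
rewrite -[X in X + _]scale1r -[X in _ + X]scale1r mxdot_pythagoras ?expr1n ?mul1r //.
by rewrite mxdot_adj QT !mulmxA mulmxBr mulmx1 QQ subrr mul0mx mxdot0r.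
Qed.

(** Spans the range of [svd_proj V r]. Comparing two such frames gives an [r] by [r] matrix, as
    [singular_pair] requires. *)
Definition svd_frame m (V : 'M[R]_m) r : 'M[R]_(m, r) :=
  locked (V *m pid_mx r).

Lemma svd_frame_orthonormal m (V : 'M[R]_m) r : (r <= m)%N -> V^T *m V = 1%:M ->
  (svd_frame V r)^T *m svd_frame V r = 1%:M.
Proof.
move=> rm VV; rewrite /svd_frame -!lock trmx_mul tr_pid_mx mulmxA -(mulmxA _ V^T) VV mulmx1.
by rewrite mul_pid_mx minnn (minn_idPr rm) pid_mx_1.
Qed.

Lemma svd_proj_frame m (V : 'M[R]_m) r :
  (r <= m)%N -> svd_proj V r = svd_frame V r *m (svd_frame V r)^T.
Proof.
move=> rm; rewrite /svd_frame /svd_proj -!lock trmx_mul tr_pid_mx mulmxA.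
rewrite -(mulmxA V _ (pid_mx r)) mul_pid_mx minnn.
by rewrite minnn.
Qed.

Lemma orthoproj_svd m (V : 'M[R]_m) r : (r <= m)%N -> V^T *m V = 1%:M ->
  orthoproj (svd_proj V r).
Proof.
move=> rm VV; split; first exact: svd_projtr.
rewrite svd_proj_frame // mulmxA -(mulmxA (svd_frame V r)).
by rewrite svd_frame_orthonormal // mulmx1.
Qed.

Lemma frobnorm_svd_proj m (V : 'M[R]_m) r : (r <= m)%N -> V^T *m V = 1%:M ->
  frobnorm (svd_proj V r) ^+ 2 = r%:R.
Proof.
move=> rm VV; have FF := svd_frame_orthonormal rm VV.
by rewrite svd_proj_frame // frobnorm_isom // frobnorm_tr frobnorm_orthonormal.
Qed.

(** Both sides are the truncation of [M]. The identity carries a projection from one side of [M] to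
    the other. *)
Lemma svd_proj_comm n m (M : 'M[R]_(n, m)) U s V r : is_svd M U s V ->
  M *m svd_proj V r = svd_proj U r *m M.
Proof. by move=> sM; rewrite -(hard_thr_proj r sM) (hard_thr_projl r sM). Qed.

Lemma svd_frame_ge n m (M : 'M[R]_(n, m)) U s V r (y : 'cV_r) :
    is_svd M U s V -> (0 < r <= m)%N ->
  s r.-1 * frobnorm y <= frobnorm (M *m (svd_frame V r *m y)).
Proof.
move=> sM /andP[r0 rm]; have [[_ VV] _ _ _ _] := sM.
rewrite -(frobnorm_isom y (svd_frame_orthonormal rm VV)).
apply: svd_head_ge sM _; rewrite prednK // /svd_frame -!lock.
by rewrite !mulmxA -(mulmxA _ V^T) VV mulmx1 mul_copid_mx_pid // mul0mx.
Qed.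

Lemma svd_proj_ge n m (M : 'M[R]_(n, m)) U s V r (x : 'cV_m) :
    is_svd M U s V -> (0 < r <= m)%N ->
  s r.-1 * frobnorm (svd_proj V r *m x) <= frobnorm (M *m (svd_proj V r *m x)).
Proof.
move=> sM rm; have [[_ VV] _ _ _ _] := sM; have [r0 rm'] := andP rm.
rewrite svd_proj_frame // -mulmxA frobnorm_isom ?svd_frame_orthonormal //.
exact: svd_frame_ge sM rm.
Qed.

Lemma svd_frame_orth_le n m (M : 'M[R]_(n, m)) U s V r (q : 'cV_m) :
    is_svd M U s V -> (r <= m)%N -> (svd_frame V r)^T *m q = 0 ->
  frobnorm (M *m q) <= s r * frobnorm q.
Proof.
move=> sM rm Vq; have := svd_tail_opbound r sM q.
by rewrite (hard_thr_proj r sM) mulmxBl svd_proj_frame // -!mulmxA Vq !mulmx0 subr0.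
Qed.

(** [gap_angle] for the coordinates of each column of [X] in the frame of [V], with threshold
    [t = st r.-1]. The orthogonality of [At z] and [At w] comes from [At Qt = Pt At]. *)
Lemma svd_gap_angle n m r (A At : 'M[R]_(n, m)) U s V Ut st Vt e k (X : 'M_(m, k)) :
    (0 < r <= m)%N -> is_svd A U s V -> is_svd At Ut st Vt ->
    opbound (A - At) e -> s r + 2 * e < s r.-1 ->
  frobnorm (svd_proj V r *m X) ^+ 2 <=
    2 * frobnorm (svd_proj Vt r *m (svd_proj V r *m X)) ^+ 2.
Proof.
move=> r0m sA sAt Ae gap; have [r0 rm] := andP r0m.
have [[_ VV] _ _ _ _] := sA; have [[_ VtVt] st0 _ _ _] := sAt.
have FF := svd_frame_orthonormal rm VV; have FtFt := svd_frame_orthonormal rm VtVt.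
rewrite !svd_proj_frame // -!mulmxA (frobnorm_isom _ FF) (frobnorm_isom _ FtFt).
rewrite !frobnorm_col mulr_sumr; apply: ler_sum => j _.
rewrite !colE -!mulmxA -colE.
apply: (gap_angle r0 FF FtFt (st0 r.-1) _ _ _ _ _ Ae gap) => [y|q|y|w|y w Vw].
- exact: svd_frame_ge sA r0m.
- exact: svd_frame_orth_le sA rm.
- exact: svd_frame_ge sAt r0m.
- move=> /(svd_frame_orth_le sAt rm) /le_trans; apply.
  by rewrite ler_wpM2r ?frobnorm_ge0 // (svd_antitone sAt) // leq_pred.
- have -> : svd_frame Vt r *m y = svd_proj Vt r *m (svd_frame Vt r *m y).
    by rewrite svd_proj_frame // mulmxA -(mulmxA (svd_frame Vt r)) FtFt mulmx1.
  rewrite mulmxA (svd_proj_comm _ sAt) -mulmxA mxdot_adj svd_projtr (mulmxA _ At w).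
  by rewrite -(svd_proj_comm _ sAt) svd_proj_frame // -!mulmxA Vw !mulmx0 mxdot0r.
Qed.

(** The left-hand side is at most [|At Qt (1 - Q) x| = |Pt At (1 - Q) x|]. Writing
    [At = A + (At - A)] and [A (1 - Q) = (1 - P) A (1 - Q)] leaves one term bounded through [u] and
    the tail of [A], and one through [e]. *)
Lemma wedin_step n m r (A At : 'M[R]_(n, m)) U s V Ut st Vt e u (x : 'cV_m) :
    (0 < r)%N -> (r <= minn n m)%N -> is_svd A U s V -> is_svd At Ut st Vt ->
    opbound (At - A) e -> 0 <= e -> 0 <= u ->
    opbound (svd_proj Ut r *m (1%:M - svd_proj U r)) u ->
  st r.-1 * frobnorm (svd_proj Vt r *m ((1%:M - svd_proj V r) *m x)) <=
    (u * s r + e) * frobnorm x.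
Proof.
move=> r0 rmn sA sAt Ae e0 u0 Pu; have [rn rm] : (r <= n)%N /\ (r <= m)%N.
  by apply/andP; rewrite -leq_min.
have [[UU VV] s0 _ _ _] := sA; have [[UtUt VtVt] _ _ _ _] := sAt.
apply: le_trans (svd_proj_ge _ sAt _) _; first by rewrite r0.
set Q := svd_proj V r; set Qt := svd_proj Vt r.
set P := svd_proj U r in Pu *; set Pt := svd_proj Ut r in Pu *.
have Qp : orthoproj Q by exact: orthoproj_svd.
have AQ : A *m (1%:M - Q) = (1%:M - P) *m A.
  by rewrite mulmxBr mulmxBl mulmx1 mul1mx (svd_proj_comm _ sA).
have -> : At *m (Qt *m ((1%:M - Q) *m x)) =
    Pt *m ((1%:M - P) *m (A *m (1%:M - Q) *m x)) +
    Pt *m ((At - A) *m ((1%:M - Q) *m x)).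
  rewrite mulmxA (svd_proj_comm _ sAt) -mulmxA -mulmxDr; congr (_ *m _).
  have [_ QQ] := orthoprojC Qp.
  by rewrite (mulmxA (1%:M - P)) (mulmxA (1%:M - P)) -AQ -(mulmxA A) QQ -mulmxA
    -mulmxDl (addrC A) subrK.
apply: le_trans (frobnormD _ _) _; rewrite mulrDl; apply: lerD.
  rewrite mulmxA -mulrA; apply: le_trans (Pu _) _; rewrite ler_wpM2l //.
  have := svd_tail_opbound r sA x.
  by rewrite (hard_thr_proj r sA) mulmxBr mulmx1.
apply: le_trans (orthoproj_le _ (orthoproj_svd rn UtUt)) _.
apply: le_trans (Ae _) _.
by rewrite ler_wpM2l // orthoproj_le //; exact: orthoprojC.
Qed.

(** [wedin_step] for [A] and for its transpose bounds each of [|X|] and [|Y|] through the other. For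
    the larger one, [a], this gives [st r.-1 a <= a (s r) + e], so [g a <= e]. *)
Lemma wedin n m r (A At : 'M[R]_(n, m)) U s V Ut st Vt e g :
    (0 < r)%N -> (r <= minn n m)%N -> is_svd A U s V -> is_svd At Ut st Vt ->
    opbound (At - A) e -> 0 <= e -> 0 < g -> s r + g <= st r.-1 ->
  opbound (svd_proj Ut r *m (1%:M - svd_proj U r)) (e / g) /\
  opbound (svd_proj Vt r *m (1%:M - svd_proj V r)) (e / g).
Proof.
move=> r0 rmn sA sAt Ae e0 g0 gap.
have Ate : opbound (At^T - A^T) e by rewrite -linearB; exact: opbound_tr.
have [_ s0 _ _ _] := sA; have st0 : 0 < st r.-1.
  by apply: lt_le_trans gap; rewrite ltr_wpDl.
set X := svd_proj Ut r *m _; set Y := svd_proj Vt r *m _.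
have rnm : (r <= minn m n)%N by rewrite minnC.
have Xle := wedin_step _ r0 rnm (svd_tr sA) (svd_tr sAt) Ate e0
  (specnorm_ge0 Y) (@specnorm_opbound _ _ Y).
have Yle := wedin_step _ r0 rmn sA sAt Ae e0
  (specnorm_ge0 X) (@specnorm_opbound _ _ X).
have {}Xle : st r.-1 * specnorm X <= specnorm Y * s r + e.
  rewrite mulrC -ler_pdivlMr //; apply: specnorm_le => [|x].
    by rewrite divr_ge0 ?addr_ge0 ?mulr_ge0 ?specnorm_ge0 // ltW.
  by rewrite mulrAC ler_pdivlMr // mulrC -mulmxA.
have {}Yle : st r.-1 * specnorm Y <= specnorm X * s r + e.
  rewrite mulrC -ler_pdivlMr //; apply: specnorm_le => [|x].
    by rewrite divr_ge0 ?addr_ge0 ?mulr_ge0 ?specnorm_ge0 // ltW.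
  by rewrite mulrAC ler_pdivlMr // mulrC -mulmxA.
move: (specnorm_ge0 X) (specnorm_ge0 Y) (s0 r) => X0 Y0 sr0.
have bound a b : 0 <= a -> b <= a -> st r.-1 * a <= b * s r + e -> a <= e / g.
  move=> a0 ba H; rewrite ler_pdivlMr //.
  have : b * s r <= a * s r by rewrite ler_wpM2r.
  have : a * (s r + g) <= a * st r.-1 by rewrite ler_wpM2l.
  lra.
have [XY|YX] := lerP (specnorm X) (specnorm Y).
  have Ye := bound _ _ Y0 XY Yle.
  by split; apply: opbound_le (@specnorm_opbound _ _ _); rewrite // (le_trans XY).
have Xe := bound _ _ X0 (ltW YX) Xle.
by split; apply: opbound_le (@specnorm_opbound _ _ _); rewrite // (le_trans (ltW YX)).
Qed.

(** * Perturbation of the truncation *)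

Lemma frobnorm_hard_thr n m (M : 'M[R]_(n, m)) U s V r : (r <= m)%N ->
  is_svd M U s V -> frobnorm (hard_thr r U s V) = Num.sqrt (\sum_(j < r) s j ^+ 2).
Proof.
move=> rm sM; have [[_ VV] _ _ _ _] := sM.
rewrite -[LHS]ger0_norm ?frobnorm_ge0 // -sqrtr_sqr; congr Num.sqrt.
rewrite (hard_thr_proj r sM) (svd_frobnorm_mul _ sM) [RHS](big_ord_widen _ (fun j => s j ^+ 2) rm).
rewrite [RHS]big_mkcond; apply: eq_bigr => i _.
rewrite /svd_proj -!lock -mulmxA mulmxA VV mul1mx frobnorm_pid_row.
have -> : frobnorm (row i V^T) = 1; last first.
  by case: ltnP => _; rewrite /= ?mul1r ?mul0r ?expr1n ?mulr1 ?mulr0.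
by rewrite -frobnorm_tr tr_row trmxK colE frobnorm_isom // frobnorm_delta.
Qed.

(** As [X Q = (X Q) Q] and [|Q|_F^2 = r], the operator bound on [X Q] also yields the Frobenius
    bound [|X Q|_F^2 <= c^2 r] that [svd_tail_le] asks for. *)
Lemma svd_tail_proj_le n m (M : 'M[R]_(n, m)) U s V r o (X Q : 'M_m) c :
    is_svd M U s V -> orthoproj Q -> frobnorm Q ^+ 2 = r%:R -> 0 <= c ->
    opbound (X *m Q) c ->
  frobnorm ((M - hard_thr o U s V) *m (X *m Q)) <=
    c * Num.sqrt (\sum_(j < r) s (o + j)%N ^+ 2).
Proof.
move=> sM [_ QQ] Qr c0 Xc; apply: svd_tail_le => //; first exact: opbound_tr.
have -> : X *m Q = X *m Q *m Q by rewrite -mulmxA QQ.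
rewrite -Qr -exprMn ler_pXn2r ?nnegrE ?mulr_ge0 ?frobnorm_ge0 //.
exact: opbound_mx.
Qed.

Lemma svd_tail_projl_le n m (M : 'M[R]_(n, m)) U s V r o (P X : 'M_n) c :
    is_svd M U s V -> orthoproj P -> frobnorm P ^+ 2 = r%:R -> 0 <= c ->
    opbound (P *m X) c ->
  frobnorm (P *m X *m (M - hard_thr o U s V)) <=
    c * Num.sqrt (\sum_(j < r) s (o + j)%N ^+ 2).
Proof.
move=> /svd_tr sM Pp Pr c0 Xc; have [PT _] := Pp.
rewrite -frobnorm_tr trmx_mul linearB /= hard_thr_tr trmx_mul PT.
apply: svd_tail_proj_le => //.
by rewrite -PT -trmx_mul; exact: opbound_tr.
Qed.

(** [A - A_r] absorbs a factor [1 - Q]; inserting it exhibits [(1 - Q) Qt], which is controlled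
    under a gap. On the complement of [Qt] the truncation of [A + E] vanishes. *)
Lemma thr_diff_split n m r (A E : 'M[R]_(n, m)) U s V Ut st Vt :
    (r <= m)%N -> is_svd A U s V -> is_svd (A + E) Ut st Vt ->
  let Qt := svd_proj Vt r in let D := hard_thr r U s V - hard_thr r Ut st Vt in
  D *m Qt = - (E *m Qt + (A - hard_thr r U s V) *m ((1%:M - svd_proj V r) *m Qt)) /\
  D *m (1%:M - Qt) = hard_thr r U s V *m (1%:M - Qt).
Proof.
move=> rm sA sAt Qt D; have [[_ VV] _ _ _ _] := sA; have [[_ VtVt] _ _ _ _] := sAt.
have [_ QQ] := orthoproj_svd rm VV; have [_ QtQt] := orthoproj_svd rm VtVt.
rewrite /D (hard_thr_proj r sA) (hard_thr_proj r sAt) -/Qt in QtQt *.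
set Q := svd_proj V r in QQ *.
have AQ : (A - A *m Q) *m (1%:M - Q) = A - A *m Q.
  by rewrite mulmxBr mulmx1 mulmxBl -mulmxA QQ subrr subr0.
split.
  rewrite (mulmxA (A - _)) AQ !mulmxBl -(mulmxA (A + E)) QtQt mulmxDl.
  by apply/matrixP => i j; rewrite !mxE; ring.
rewrite mulmxBl [X in _ - X](_ : _ = 0) ?subr0 //.
by rewrite -mulmxA mulmxBr mulmx1 QtQt subrr mulmx0.
Qed.

(** [Pt (A + E) = (A + E) Qt] is killed by [1 - Qt], and [Pt A - Pt A_r = Pt (1 - P) (A - A_r)]. *)
Lemma thr_compl_eq n m r (A E : 'M[R]_(n, m)) U s V Ut st Vt :
    (r <= minn n m)%N -> is_svd A U s V -> is_svd (A + E) Ut st Vt ->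
  let Pt := svd_proj Ut r in let Qtc := 1%:M - svd_proj Vt r in
  Pt *m (hard_thr r U s V *m Qtc) =
    - (Pt *m E + Pt *m (1%:M - svd_proj U r) *m (A - hard_thr r U s V)) *m Qtc.
Proof.
move=> rmn sA sAt Pt Qtc; have [rn rm] : (r <= n)%N /\ (r <= m)%N.
  by apply/andP; rewrite -leq_min.
have [[UU VV] _ _ _ _] := sA; have [[UtUt VtVt] _ _ _ _] := sAt.
have [_ QtQt] := orthoproj_svd rm VtVt.
have AtQ : Pt *m (A + E) *m Qtc = 0.
  rewrite -(svd_proj_comm _ sAt) -mulmxA mulmxBr mulmx1 QtQt subrr mulmx0 //.
have -> : Pt *m (1%:M - svd_proj U r) *m (A - hard_thr r U s V) =
    Pt *m A - Pt *m hard_thr r U s V.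
  have [_ PcPc] := orthoprojC (orthoproj_svd rn UU).
  have AtE : A - hard_thr r U s V = (1%:M - svd_proj U r) *m A.
    by rewrite (hard_thr_projl r sA) mulmxBl mul1mx.
  by rewrite -mulmxBr AtE -mulmxA (mulmxA (1%:M - _)) PcPc.
rewrite (mulmxDr Pt A) in AtQ.
apply/eqP; rewrite -subr_eq0 -[X in _ == X]AtQ mulNmx opprK mulmxA -mulmxDl.
by rewrite addrCA (addrC (Pt *m hard_thr _ _ _ _)) subrK (addrC (Pt *m E)).
Qed.

(** Wedin's bound with [g] half of [s r.-1 - s r], so that [e / g = mu]. As [e < g], Weyl's
    inequality gives [st r.-1 >= s r.-1 - e >= s r + g]. *)
Lemma spectral_perturbation_gap n m r (A E : 'M[R]_(n, m)) U s V Ut st Vt e mu :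
    (0 < r)%N -> (r <= minn n m)%N -> is_svd A U s V -> is_svd (A + E) Ut st Vt ->
    opbound E e -> 0 <= e -> s r + 2 * e < s r.-1 -> mu = 2 * e / (s r.-1 - s r) ->
  [/\ 0 <= mu, opbound (svd_proj Ut r *m (1%:M - svd_proj U r)) mu &
      opbound ((1%:M - svd_proj V r) *m svd_proj Vt r) mu].
Proof.
move=> r0 rmn sA sAt Ee e0 gap ->.
have EA : opbound (A + E - A) e by rewrite addrC addKr.
have AE : opbound (A - (A + E)) e.
  by move=> x; rewrite opprD addNKr mulNmx frobnormN; exact: Ee.
have d0 : 0 < s r.-1 - s r by lra.
have gap' : s r + (s r.-1 - s r) / 2 <= st r.-1.
  by have := weyl_svd r.-1 sA sAt e0 AE; lra.
have [|H1 H2] := wedin r0 rmn sA sAt EA e0 _ gap'; first by rewrite divr_gt0.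
have muE : 2 * e / (s r.-1 - s r) = e / ((s r.-1 - s r) / 2).
  by rewrite invf_div mulrA (mulrC e).
have mu0 : 0 <= 2 * e / (s r.-1 - s r) by rewrite divr_ge0 ?(ltW d0) // mulr_ge0.
rewrite muE in mu0 *; split=> //.
have := opbound_tr mu0 H2; rewrite trmx_mul linearB /= trmx1 !svd_projtr.
by [].
Qed.

(** The angle bound is needed for left singular spaces, hence the transposes. Applied to [A Y], with
    [P A = A_r], it gives [|A_r Y|^2 <= 2 |Pt A_r Y|^2], and [thr_compl_eq] rewrites [Pt A_r Y]. *)
Lemma thr_compl_le n m r k (A E : 'M[R]_(n, m)) U s V Ut st Vt e (Y : 'M_(m, k)) :
    (0 < r)%N -> (r <= minn n m)%N -> is_svd A U s V -> is_svd (A + E) Ut st Vt ->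
    opbound E e -> 0 <= e -> s r + 2 * e < s r.-1 ->
    (1%:M - svd_proj Vt r) *m Y = Y ->
  frobnorm (hard_thr r U s V *m Y) ^+ 2 <=
    2 * frobnorm ((svd_proj Ut r *m E + svd_proj Ut r *m (1%:M - svd_proj U r) *m
                    (A - hard_thr r U s V)) *m Y) ^+ 2.
Proof.
move=> r0 rmn sA sAt Ee e0 gap QY; have [rn rm] : (r <= n)%N /\ (r <= m)%N.
  by apply/andP; rewrite -leq_min.
have AE : opbound (A^T - (A + E)^T) e.
  rewrite -linearB /= opprD addNKr; apply: opbound_tr => // x.
  rewrite mulNmx frobnormN; exact: Ee.
have r0n : (0 < r <= n)%N by rewrite r0.
have := svd_gap_angle (A *m Y) r0n (svd_tr sA) (svd_tr sAt) AE gap.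
rewrite (mulmxA (svd_proj U r)) -(hard_thr_projl r sA) => /le_trans; apply.
rewrite -{1}QY (mulmxA (hard_thr _ _ _ _)) mulmxA (thr_compl_eq rmn sA sAt).
by rewrite -(mulmxA _ _ Y) QY mulNmx frobnormN.
Qed.

(** * Bounds in the spectral norm *)

Lemma specnorm_thr_gap n m r (A E : 'M[R]_(n, m)) U s V Ut st Vt e mu :
    (0 < r)%N -> (r <= minn n m)%N -> is_svd A U s V -> is_svd (A + E) Ut st Vt ->
    opbound E e -> 0 <= e -> s r + 2 * e < s r.-1 -> mu = 2 * e / (s r.-1 - s r) ->
  specnorm (hard_thr r U s V - hard_thr r Ut st Vt) <= 2 * (e + s r * mu).
Proof.
move=> r0 rmn sA sAt Ee e0 gap muE; have [rn rm] : (r <= n)%N /\ (r <= m)%N.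
  by apply/andP; rewrite -leq_min.
have [mu0 Pmu Qmu] := spectral_perturbation_gap r0 rmn sA sAt Ee e0 gap muE.
have [[UU VV] s0 _ _ _] := sA; have [[UtUt VtVt] _ _ _ _] := sAt.
have [DQ DQc] := thr_diff_split rm sA sAt.
have thrc := thr_compl_eq rmn sA sAt.
set Ar := hard_thr r U s V in DQ DQc thrc *; set D := Ar - _ in DQ DQc *.
have Qtp := orthoproj_svd rm VtVt; have Ptp := orthoproj_svd rn UtUt.
set Qt := svd_proj Vt r in DQ DQc thrc Qmu Qtp; set Pt := svd_proj Ut r in Pmu Ptp thrc.
set a := e + s r * mu; have a0 : 0 <= a by rewrite addr_ge0 ?mulr_ge0.
have Atail : opbound (A - Ar) (s r) by exact: svd_tail_opbound.
apply: specnorm_le => [|x]; first by rewrite mulr_ge0.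
have [_ QtQt] := Qtp.
have DQx : frobnorm (D *m (Qt *m x)) <= a * frobnorm (Qt *m x).
  have -> : D *m (Qt *m x) = - (E *m (Qt *m x) +
      (A - Ar) *m ((1%:M - svd_proj V r) *m Qt *m (Qt *m x))).
    by rewrite mulmxA DQ mulNmx (mulmxDl (E *m Qt)) -!mulmxA (mulmxA Qt Qt) QtQt.
  rewrite frobnormN; apply: le_trans (frobnormD _ _) _; rewrite mulrDl.
  apply: lerD; first exact: Ee.
  by apply: le_trans (Atail _) _; rewrite -mulrA ler_wpM2l.
have DQcx : frobnorm (D *m ((1%:M - Qt) *m x)) ^+ 2 <=
    2 * (a ^+ 2 * frobnorm ((1%:M - Qt) *m x) ^+ 2).
  rewrite mulmxA DQc -mulmxA; apply: le_trans (thr_compl_le r0 rmn sA sAt Ee e0 gap _) _.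
    by rewrite mulmxA; have [_ ->] := orthoprojC Qtp.
  rewrite ler_pM2l // -exprMn ler_pXn2r ?nnegrE ?mulr_ge0 ?frobnorm_ge0 // mulmxDl.
  apply: le_trans (frobnormD _ _) _; rewrite mulrDl; apply: lerD.
    by rewrite -mulmxA; apply: le_trans (orthoproj_le _ Ptp) _; exact: Ee.
  rewrite -mulmxA; apply: le_trans (Pmu _) _; rewrite (mulrC (s r)) -mulrA ler_wpM2l //.
have -> : D *m x = D *m (Qt *m x) + D *m ((1%:M - Qt) *m x).
  by rewrite -mulmxDr -mulmxDl addrC subrK mul1mx.
apply: le_trans (frobnormD _ _) _.
rewrite -(@ler_pXn2r _ 2) ?nnegrE ?mulr_ge0 ?addr_ge0 ?frobnorm_ge0 ?mulr_ge0 //.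
rewrite exprMn [X in _ * X](orthoproj_pythagoras x Qtp).
have {}DQx : frobnorm (D *m (Qt *m x)) ^+ 2 <= a ^+ 2 * frobnorm (Qt *m x) ^+ 2.
  by rewrite -exprMn ler_pXn2r ?nnegrE ?mulr_ge0 ?frobnorm_ge0.
move: (frobnorm (D *m (Qt *m x))) (frobnorm (D *m ((1%:M - Qt) *m x))) DQx DQcx => b c Hb Hc.
(* This square gives [(b + c)^2 <= 3 b^2 + 3/2 c^2], which is at most [3 (u + v)] since [b^2 <= u]
   and [c^2 <= 2 v]. *)
have := sqr_ge0 (2 * b - c); have := mulr_ge0 (sqr_ge0 a) (sqr_ge0 (frobnorm (Qt *m x))).
have := mulr_ge0 (sqr_ge0 a) (sqr_ge0 (frobnorm ((1%:M - Qt) *m x))).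
rewrite exprMn -mulrA (mulrDr (a ^+ 2)).
move: (a ^+ 2 * _) Hb (a ^+ 2 * _) Hc => u Hu v Hv; lra.
Qed.

(** [A_r - At_r = (A + E - At_r) - E - (A - A_r)], and Weyl's inequality bounds the first tail by
    [s r + e]. *)
Lemma specnorm_thr_trivial n m r (A E : 'M[R]_(n, m)) U s V Ut st Vt e :
    is_svd A U s V -> is_svd (A + E) Ut st Vt -> opbound E e -> 0 <= e ->
  specnorm (hard_thr r U s V - hard_thr r Ut st Vt) <= 2 * e + 2 * s r.
Proof.
move=> sA sAt Ee e0; have [_ s0 _ _ _] := sA.
have st_le : st r <= s r + e.
  by apply: weyl_svd sAt sA e0 _; rewrite addrC addKr.
apply: specnorm_le => [|x]; first by rewrite addr_ge0 ?mulr_ge0.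
have -> : (hard_thr r U s V - hard_thr r Ut st Vt) *m x =
    (A + E - hard_thr r Ut st Vt) *m x - (E *m x + (A - hard_thr r U s V) *m x).
  by rewrite -mulmxDl -mulmxBl; congr (_ *m _); apply/matrixP => i j; rewrite !mxE; ring.
apply: le_trans (frobnormB _ _) _.
apply: le_trans (lerD (svd_tail_opbound r sAt x) (frobnormD _ _)) _.
apply: le_trans (lerD (lexx _) (lerD (Ee x) (svd_tail_opbound r sA x))) _.
have : st r * frobnorm x <= (s r + e) * frobnorm x by rewrite ler_wpM2r ?frobnorm_ge0.
lra.
Qed.

(** * Bounds in the Frobenius norm *)

Lemma frobnorm_pythagoras_r n m (Q : 'M[R]_m) (D : 'M[R]_(n, m)) : orthoproj Q ->
  frobnorm D ^+ 2 = frobnorm (D *m Q) ^+ 2 + frobnorm (D *m (1%:M - Q)) ^+ 2.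
Proof.
move=> Qp; have [QcT _] := orthoprojC Qp; have [QT _] := Qp.
rewrite -frobnorm_tr (orthoproj_pythagoras _ Qp) -[in RHS](frobnorm_tr (D *m Q)).
by rewrite -[in RHS](frobnorm_tr (D *m _)) !trmx_mul QcT QT.
Qed.

(** A projection of rank [r] on either side captures at most the [r] largest singular values of [E]:
    the tail bounds with offset [0] and [c = 1]. *)
Lemma frobnorm_svd_le n m r (E : 'M[R]_(n, m)) UE sE VE :
    is_svd E UE sE VE -> (r <= minn n m)%N ->
  (forall Q : 'M_m, orthoproj Q -> frobnorm Q ^+ 2 = r%:R ->
    frobnorm (E *m Q) <= frobnorm (hard_thr r UE sE VE)) /\
  (forall P : 'M_n, orthoproj P -> frobnorm P ^+ 2 = r%:R ->
    frobnorm (P *m E) <= frobnorm (hard_thr r UE sE VE)).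
Proof.
move=> sE' rmn; have [rn rm] : (r <= n)%N /\ (r <= m)%N by apply/andP; rewrite -leq_min.
rewrite (frobnorm_hard_thr rm sE'); split=> [Q Qp Qr|P Pp Pr].
  have := @svd_tail_proj_le _ _ _ _ _ _ r 0 1%:M _ 1 sE' Qp Qr ler01.
  by rewrite hard_thr0 subr0 !mul1mx mul1r; apply; exact: orthoproj_opbound.
have := @svd_tail_projl_le _ _ _ _ _ _ r 0 _ 1%:M 1 sE' Pp Pr ler01.
by rewrite hard_thr0 subr0 !mulmx1 mul1r; apply; exact: orthoproj_opbound.
Qed.

(** The constant is [3 = 1 + 2]: [D Qt] contributes [f^2], and [D (1 - Qt)] contributes [2 f^2]
    through the factor 2 of [thr_compl_le]. *)
Lemma frobnorm_thr_gap n m r (A E : 'M[R]_(n, m)) U s V Ut st Vt UE sE VE e mu :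
    (0 < r)%N -> (r <= minn n m)%N -> is_svd A U s V -> is_svd (A + E) Ut st Vt ->
    is_svd E UE sE VE ->
    opbound E e -> 0 <= e -> s r + 2 * e < s r.-1 -> mu = 2 * e / (s r.-1 - s r) ->
  frobnorm (hard_thr r U s V - hard_thr r Ut st Vt) ^+ 2 <=
    3 * (frobnorm (hard_thr r UE sE VE) +
         Num.sqrt (\sum_(k < r) s (r + k)%N ^+ 2) * mu) ^+ 2.
Proof.
move=> r0 rmn sA sAt sE' Ee e0 gap muE; have [rn rm] : (r <= n)%N /\ (r <= m)%N.
  by apply/andP; rewrite -leq_min.
have [mu0 Pmu Qmu] := spectral_perturbation_gap r0 rmn sA sAt Ee e0 gap muE.
have [[UU VV] _ _ _ _] := sA; have [[UtUt VtVt] _ _ _ _] := sAt.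
have [DQ DQc] := thr_diff_split rm sA sAt.
have Qtp := orthoproj_svd rm VtVt; have Ptp := orthoproj_svd rn UtUt.
have Qtr := frobnorm_svd_proj rm VtVt; have Ptr := frobnorm_svd_proj rn UtUt.
have [EQ PE] := frobnorm_svd_le sE' rmn.
have Qctp := orthoprojC Qtp; have [_ QcQc] := Qctp.
set f := frobnorm _ + _; rewrite (frobnorm_pythagoras_r _ Qtp) DQ DQc.
have f1 : frobnorm (E *m svd_proj Vt r + (A - hard_thr r U s V) *m
    ((1%:M - svd_proj V r) *m svd_proj Vt r)) <= f.
  apply: le_trans (frobnormD _ _) _; apply: lerD; first exact: EQ.
  by rewrite mulrC; exact: svd_tail_proj_le.
have := thr_compl_le r0 rmn sA sAt Ee e0 gap QcQc.
set G := (svd_proj Ut r *m E + _) *m _ => H.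
have f2 : frobnorm G <= f.
  apply: le_trans (orthoproj_ler _ Qctp) _.
  apply: le_trans (frobnormD _ _) _; apply: lerD; first exact: PE.
  by rewrite mulrC; exact: svd_tail_projl_le.
rewrite frobnormN.
have sq x : 0 <= x -> x <= f -> x ^+ 2 <= f ^+ 2.
  by move=> x0 xf; rewrite ler_pXn2r ?nnegrE ?(le_trans x0 xf).
have := sq _ (frobnorm_ge0 _) f1; have := sq _ (frobnorm_ge0 _) f2.
lra.
Qed.

(** The two parts of [D] are at most [eps + S] and [S + 2 eps]. Their squares add up to
    [5 eps^2 + 6 eps S + 2 S^2], which is the right-hand side less [S^2]. *)
Lemma frobnorm_thr_trivial n m r (A E : 'M[R]_(n, m)) U s V Ut st Vt UE sE VE :
    (r <= minn n m)%N -> is_svd A U s V -> is_svd (A + E) Ut st Vt ->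
    is_svd E UE sE VE ->
  frobnorm (hard_thr r U s V - hard_thr r Ut st Vt) ^+ 2 <=
    2 * frobnorm (hard_thr r UE sE VE) ^+ 2 +
    3 * (frobnorm (hard_thr r UE sE VE) + Num.sqrt (\sum_(k < r) s (r + k)%N ^+ 2)) ^+ 2.
Proof.
move=> rmn sA sAt sE'; have [rn rm] : (r <= n)%N /\ (r <= m)%N.
  by apply/andP; rewrite -leq_min.
have [[UU VV] _ _ _ _] := sA; have [[UtUt VtVt] _ _ _ _] := sAt.
have [DQ DQc] := thr_diff_split rm sA sAt.
have Qp := orthoproj_svd rm VV; have Pp := orthoproj_svd rn UU.
have Qtp := orthoproj_svd rm VtVt; have Qctp := orthoprojC Qtp.
have Qtr := frobnorm_svd_proj rm VtVt; have Pr := frobnorm_svd_proj rn UU.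
have [EQ PE] := frobnorm_svd_le sE' rmn.
have tails := svd_tail_sum_le rm sA sAt sE'; rewrite -(frobnorm_hard_thr rm sE') in tails.
set eps := frobnorm (hard_thr _ _ _ _) in EQ PE tails *.
set S := Num.sqrt (\sum_(k < r) s (r + k)%N ^+ 2) in tails *.
have eps0 : 0 <= eps by exact: frobnorm_ge0.
have S0 : 0 <= S by exact: sqrtr_ge0.
rewrite (frobnorm_pythagoras_r _ Qtp) DQ DQc frobnormN.
have f1 : frobnorm (E *m svd_proj Vt r + (A - hard_thr r U s V) *m
    ((1%:M - svd_proj V r) *m svd_proj Vt r)) <= eps + S.
  apply: le_trans (frobnormD _ _) _; apply: lerD; first exact: EQ.
  rewrite -[leRHS]mul1r; apply: svd_tail_proj_le => //.
  have := opboundM ler01 (orthoproj_opbound (orthoprojC Qp)) (orthoproj_opbound Qtp).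
  by rewrite mulr1.
have f2 : frobnorm (hard_thr r U s V *m (1%:M - svd_proj Vt r)) <= S + 2 * eps.
  (* [P A (1 - Qt)] with [A = (A + E) - E]: the tail of [A + E] costs at most [S + eps] by
     [svd_tail_sum_le], the term in [E] another [eps]. *)
  have -> : hard_thr r U s V *m (1%:M - svd_proj Vt r) =
      svd_proj U r *m 1%:M *m (A + E - hard_thr r Ut st Vt) -
      svd_proj U r *m E *m (1%:M - svd_proj Vt r).
    rewrite (hard_thr_projl r sA) (hard_thr_proj r sAt) mulmx1.
    rewrite -[X in X - (A + E) *m _]mulmx1 -mulmxBr mulmxA -mulmxBl.
    by rewrite (mulmxDr _ A) addrK.
  apply: le_trans (frobnormB _ _) _.
  have H1 : frobnorm (svd_proj U r *m E *m (1%:M - svd_proj Vt r)) <= eps.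
    by apply: le_trans (orthoproj_ler _ Qctp) _; exact: PE.
  have := @svd_tail_projl_le _ _ _ _ _ _ r r _ 1%:M 1 sAt Pp Pr ler01.
  rewrite mulmx1 mul1r => /(_ (orthoproj_opbound Pp)) H2; lra.
have sq (x y : R) : 0 <= x -> x <= y -> x ^+ 2 <= y ^+ 2.
  by move=> x0 xy; rewrite ler_pXn2r ?nnegrE ?(le_trans x0 xy).
have := sq _ _ (frobnorm_ge0 _) f1; have := sq _ _ (frobnorm_ge0 _) f2.
have := sqr_ge0 S; lra.
Qed.

End TruncatedSVD.

(* Singular values are 0-indexed: s k = sigma_{k+1}.  So sigma_r = s (r-1),
   sigma_{r+1} = s r, and ||(Sigma_2)_r||_F^2 = sum_{k<r} sigma_{r+1+k}^2
   = sum_{k<r} s (r+k)^2. *)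
Theorem theorem3p13 (R : realType) (n m r : nat)
    (A E : 'M[R]_(n, m))
    (U : 'M[R]_n) (s : nat -> R) (V : 'M[R]_m)
    (Ut : 'M[R]_n) (st : nat -> R) (Vt : 'M[R]_m)
    (UE : 'M[R]_n) (sE : nat -> R) (VE : 'M[R]_m) :
  (1 <= r)%N -> (r < minn n m)%N ->
  is_svd A U s V ->
  is_svd (A + E) Ut st Vt ->
  is_svd E UE sE VE ->
  let Ar := hard_thr r U s V in
  let Atr := hard_thr r Ut st Vt in
  let Er := hard_thr r UE sE VE in
  let mu := min_ratio1 (2 * specnorm E) (s r.-1 - s r) in
  specnorm (Ar - Atr) <= 2 * specnorm E + 2 * s r * mu /\
  frobnorm (Ar - Atr) <=
    Num.sqrt (2 * frobnorm Er ^+ 2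
      + 3 * (frobnorm Er
             + Num.sqrt (\sum_(k < r) s (r + k)%N ^+ 2) * mu) ^+ 2).
Proof.
move=> r0 /ltnW rmn sA sAt sE' Ar Atr Er mu.
have Ee : opbound E (specnorm E) := @specnorm_opbound _ _ _ E.
have e0 := specnorm_ge0 E; set e := specnorm E in mu Ee e0 *.
have sr : s r <= s r.-1 by apply: svd_antitone sA _; exact: leq_pred.
rewrite -[frobnorm (Ar - Atr)]ger0_norm ?frobnorm_ge0 // -sqrtr_sqr.
(* The split is at [2 e] equal to the gap, where the ratio in [mu] reaches 1. *)
have [gap|gap] := ltP (s r + 2 * e) (s r.-1).
  have d0 : 0 < s r.-1 - s r by lra.
  have muE : mu = 2 * e / (s r.-1 - s r).
    rewrite /mu /min_ratio1 gt_eqF //; apply/min_idPl.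
    rewrite ler_pdivrMr // mul1r; lra.
  split.
    apply: le_trans (specnorm_thr_gap r0 rmn sA sAt Ee e0 gap muE) _; lra.
  rewrite ler_wsqrtr //; apply: le_trans (frobnorm_thr_gap r0 rmn sA sAt sE' Ee e0 gap muE) _.
  by rewrite lerDr mulr_ge0 ?sqr_ge0.
(* Either the gap is zero and [min_ratio1] is 1 by convention, or the ratio is at least 1. *)
have -> : mu = 1.
  rewrite /mu /min_ratio1; case: eqVneq => // d0; apply/min_idPr.
  rewrite ler_pdivlMr ?mul1r; first lra.
  by rewrite lt_def d0 subr_ge0.
split; first by rewrite mulr1; exact: specnorm_thr_trivial sA sAt Ee e0.
by rewrite mulr1 ler_wsqrtr //; exact: frobnorm_thr_trivial rmn sA sAt sE'.
Qed.
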